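(* Let $n\ge 2$, let $X\in C^4(B,\mathbb R^{n+2})$ be a conformally parametrized immersion, and let $\mathcal N$ be an orthonormal normal section (ONS) of $X$ that is critical for the functional of total torsion $\mathcal T_X$. Let $\mathcal S=(S_{\sigma,12}^\vartheta)_{1\le\sigma<\vartheta\le n}:B\to\mathbb R^{n(n-1)/2}$ be the associated curvature vector of the normal bundle and suppose $\mathcal S\not\equiv 0$. (I) If $\mathcal S$ is not constant, and $\varrho\in(0,1)$ is chosen such that $\|\mathcal S\|_{2,\varrho}>0$, then $$\mathcal T_X(\mathcal N)\ \ge\ \bigg(\sqrt{n-2}\,\|\mathcal S\|_\infty+\frac{\|\mathcal S\|_2^2}{(1-\varrho)^2\,\|\mathcal S\|_{2,\varrho}^2}+\frac{2\|\nabla\mathcal S\|_2^2}{\|\mathcal S\|_{2,\varrho}^2}\bigg)^{-1}\|\mathcal S\|_{2,\varrho}^2\ >\ 0.$$ (II) If $\mathcal S$ is constant (and nonzero), then $$\mathcal T_X(\mathcal N)\ \ge\ \frac12\,\frac{\pi|\mathcal S|^2}{\sqrt{n-2}\,|\mathcal S|+16}.$$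
   Context: $B=\{(u,v)\in\mathbb R^2: u^2+v^2\le 1\}$ is the closed unit disc and $B_\varrho(0)=\{w\in\mathbb R^2:|w|\le\varrho\}$; write $u^1=u$, $u^2=v$, and let subscripts $u,v,u^i$ denote partial derivatives. Immersion: $X\in C^4(B,\mathbb R^{n+2})$ with $X_u,X_v$ linearly independent at every point of $B$. Conformally parametrized means $h_{ij}:=X_{u^i}\cdot X_{u^j}=W\delta_{ij}$ in $B$ for $i,j=1,2$, where $W=\sqrt{h_{11}h_{22}-h_{12}^2}>0$; $(h^{ij})$ is the inverse matrix of $(h_{ij})$. An orthonormal normal section (ONS) of $X$ is a family $\mathcal N=\{N_1,\ldots,N_n\}$ with $N_\sigma\in C^3(B,\mathbb R^{n+2})$, $X_{u^j}\cdot N_\sigma=0$ and $N_\sigma\cdot N_\vartheta=\delta_{\sigma\vartheta}$ in $B$ for all $j=1,2$, $\sigma,\vartheta=1,\ldots,n$. Its torsion coefficients are $T_{\sigma,i}^\vartheta:=N_{\sigma,u^i}\cdot N_\vartheta$ (skew-symmetric in $\sigma,\vartheta$). Curvature coefficients of the normal bundle: $S_{\sigma,ij}^\vartheta:=\partial_{u^j}T_{\sigma,i}^\vartheta-\partial_{u^i}T_{\sigma,j}^\vartheta+\sum_{\omega=1}^n\big(T_{\sigma,i}^\omega T_{\omega,j}^\vartheta-T_{\sigma,j}^\omega T_{\omega,i}^\vartheta\big)$; these are $C^1$ functions on $B$. Functional of total torsion: $\mathcal T_X(\mathcal N):=\sum_{\sigma,\vartheta=1}^n\iint_B\sum_{i,j=1}^2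 h^{ij}T_{\sigma,i}^\vartheta T_{\sigma,j}^\vartheta\,W\,du\,dv$, which for conformally parametrized $X$ equals $2\sum_{1\le\sigma<\vartheta\le n}\iint_B\{(T_{\sigma,1}^\vartheta)^2+(T_{\sigma,2}^\vartheta)^2\}\,du\,dv$. Critical: $\mathcal N$ is critical for $\mathcal T_X$ if $\frac{d}{d\varepsilon}\mathcal T_X(\widetilde{\mathcal N}^\varepsilon)\big|_{\varepsilon=0}=0$ for every family $\mathbf R=(r_{\sigma\vartheta})\in C^\infty(B\times(-\varepsilon_0,\varepsilon_0),SO(n))$, $\varepsilon_0>0$, with $\mathbf R(\cdot,0)$ equal to the identity matrix, where $\widetilde N^\varepsilon_\sigma=\sum_{\vartheta=1}^n r_{\sigma\vartheta}(\cdot,\varepsilon)N_\vartheta$. Norms: $|\cdot|$ is the Euclidean norm, $|\nabla\mathcal S|^2=|\mathcal S_u|^2+|\mathcal S_v|^2$; $\|Z\|_{p,\varrho}$ is the $L^p(B_\varrho(0))$-norm of $|Z|$, and $\|Z\|_p:=\|Z\|_{p,1}$ (for $p\in[1,\infty]$). *)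

(* Defs.v *)
From HB Require Import structures.
From mathcomp Require Import all_boot all_order all_algebra.
From mathcomp Require Import all_classical all_reals all_analysis.

Set Implicit Arguments.
Unset Strict Implicit.
Unset Printing Implicit Defensive.

Import Order.TTheory GRing.Theory Num.Theory.
Import numFieldNormedType.Exports.

Local Open Scope classical_set_scope.
Local Open Scope ring_scope.

Section Smoothness.
Context {R : realType} {V : normedModType R}.
Implicit Types (A : set V) (v : V) (f : V -> R).

(* Derivative of f along v on a set A that need not be open: at an interior
   point it is the usual derivative, elsewhere it is the limit of the
   derivatives at nearby interior points.  The values of f outside A are thus
   irrelevant. *)
Definition pder A v f (w : V) : R :=
  if w \in (A° : set V) then 'D_v f w
  else lim ('D_v f x @[x --> within A° (nbhs w)]).

(* f is of class C^k on A, for the partial derivatives along the vectors in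
   dirs: the partial derivatives of order <= k exist in the interior of A and
   extend continuously to A. *)
Fixpoint Ck A (dirs : seq V) (k : nat) f : Prop :=
  if k is k'.+1 then
    [/\ {within A, continuous f},
        (forall v, v \in dirs -> forall w, A° w -> derivable f w v) &
        (forall v, v \in dirs -> Ck A dirs k' (pder A v f))]
  else {within A, continuous f}.

End Smoothness.

Notation mu2 := (lebesgue_measure \x lebesgue_measure)%E.

(* The index set of R^{n(n-1)/2} *)
Notation upper_pair n := {p : 'I_n * 'I_n | (p.1 < p.2)%N}.

Section Surfaces.
Context {R : realType}.

Definition disc (rho : R) : set (R * R) :=
  [set w | w.1 ^+ 2 + w.2 ^+ 2 <= rho ^+ 2].

Definition B : set (R * R) := disc 1.

(* The index 0 : 'I_2 stands for u^1 = u, the index 1 for u^2 = v. *)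
Definition dir (i : 'I_2) : R * R := if i == 0 then (1, 0) else (0, 1).

Definition pd (i : 'I_2) (f : R * R -> R) : R * R -> R := pder B (dir i) f.

Definition CkB (k : nat) (f : R * R -> R) : Prop := Ck B (codom dir) k f.

Definition pdv m (i : 'I_2) (F : R * R -> 'rV[R]_m) (w : R * R) : 'rV[R]_m :=
  \row_j pd i (fun x => F x 0 j) w.

Definition CkBv m (k : nat) (F : R * R -> 'rV[R]_m) : Prop :=
  forall j, CkB k (fun x => F x 0 j).

Definition dot m (x y : 'rV[R]_m) : R := \sum_j x 0 j * y 0 j.

Definition immersion m (X : R * R -> 'rV[R]_m) : Prop :=
  forall w, B w -> free [:: pdv 0 X w; pdv 1 X w].

Definition metric m (X : R * R -> 'rV[R]_m) (w : R * R) : 'M[R]_2 :=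
  \matrix_(i, j) dot (pdv i X w) (pdv j X w).

Definition area_elt m (X : R * R -> 'rV[R]_m) (w : R * R) : R :=
  Num.sqrt (metric X w 0 0 * metric X w 1 1 - metric X w 0 1 ^+ 2).

Definition conformally_parametrized m (X : R * R -> 'rV[R]_m) : Prop :=
  forall w, B w -> forall i j,
    metric X w i j = area_elt X w * (i == j)%:R.

Definition ONS n m (X : R * R -> 'rV[R]_m)
    (N : 'I_n -> R * R -> 'rV[R]_m) : Prop :=
  [/\ forall s, CkBv 3 (N s),
      forall w, B w -> forall i s, dot (pdv i X w) (N s w) = 0 &
      forall w, B w -> forall s t, dot (N s w) (N t w) = (s == t)%:R].

(* torsion N s t i is T_{s,i}^t *)
Definition torsion n m (N : 'I_n -> R * R -> 'rV[R]_m)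
    (s t : 'I_n) (i : 'I_2) (w : R * R) : R :=
  dot (pdv i (N s) w) (N t w).

(* curvature N s t i j is S_{s,ij}^t *)
Definition curvature n m (N : 'I_n -> R * R -> 'rV[R]_m)
    (s t : 'I_n) (i j : 'I_2) (w : R * R) : R :=
  pd j (torsion N s t i) w - pd i (torsion N s t j) w
  + \sum_(o < n) (torsion N s o i w * torsion N o t j w
                  - torsion N s o j w * torsion N o t i w).

Definition total_torsion n m (X : R * R -> 'rV[R]_m)
    (N : 'I_n -> R * R -> 'rV[R]_m) : R :=
  \sum_(s < n) \sum_(t < n) \int[mu2]_(w in B)
    ((\sum_(i < 2) \sum_(j < 2)
       invmx (metric X w) i j * torsion N s t i w * torsion N s t j w)
     * area_elt X w).

Definition cyl (eps0 : R) : set (R * R * R) :=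
  B `*` [set e | - eps0 < e < eps0].

Definition cyl_dirs : seq (R * R * R) :=
  [:: (1, 0, 0); (0, 1, 0); (0, 0, 1)].

(* r lies in C^oo(B x (-eps0, eps0), SO(n)) and r(., 0) is the identity *)
Definition rotation_family n (eps0 : R) (r : R * R -> R -> 'M[R]_n) : Prop :=
  [/\ forall (k : nat) s t,
        Ck (cyl eps0) cyl_dirs k (fun p => r p.1 p.2 s t),
      forall w e, cyl eps0 (w, e) ->
        r w e *m (r w e)^T = 1%:M /\ \det (r w e) = 1 &
      forall w, B w -> r w 0 = 1%:M].

Definition rotate n m (Q : R * R -> 'M[R]_n)
    (N : 'I_n -> R * R -> 'rV[R]_m) (s : 'I_n) (w : R * R) : 'rV[R]_m :=
  \sum_(t < n) Q w s t *: N t w.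

Definition critical n m (X : R * R -> 'rV[R]_m)
    (N : 'I_n -> R * R -> 'rV[R]_m) : Prop :=
  forall (eps0 : R) (r : R * R -> R -> 'M[R]_n),
    0 < eps0 -> rotation_family eps0 r ->
    is_derive (0 : R) (1 : R)
      (fun e : R => total_torsion X (rotate (fun w => r w e) N) : R) 0.

Definition curvature_vector n m (N : 'I_n -> R * R -> 'rV[R]_m)
    (w : R * R) : {ffun upper_pair n -> R} :=
  [ffun p => curvature N (val p).1 (val p).2 0 1 w].

Definition enorm (I : finType) (x : {ffun I -> R}) : R :=
  Num.sqrt (\sum_i x i ^+ 2).

Definition pdf (I : finType) (i : 'I_2) (Z : R * R -> {ffun I -> R})
    (w : R * R) : {ffun I -> R} :=
  [ffun p => pd i (fun x => Z x p) w].

Definition grad_norm (I : finType) (Z : R * R -> {ffun I -> R})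
    (w : R * R) : R :=
  Num.sqrt (enorm (pdf 0 Z w) ^+ 2 + enorm (pdf 1 Z w) ^+ 2).

(* The L^p-norm over disc rho of a scalar function, as the L^p-norm over the
   plane of its extension by 0.  It is only used for functions that are
   continuous on B, for which it is finite. *)
Definition Lp_norm (p : \bar R) (rho : R) (f : R * R -> R) : R :=
  fine ('N[mu2]_p [EFin \o (f \_ (disc rho))])%E.

End Surfaces.

Arguments B : clear implicits.

(* Main.v *)
Require Import Defs.
From HB Require Import structures.
From mathcomp Require Import all_boot all_order all_algebra.
From mathcomp Require Import all_classical all_reals all_analysis.
From mathcomp Require Import ring lra ess_sup_inf.

Set Implicit Arguments.
Unset Strict Implicit.
Unset Printing Implicit Defensive.

Import Order.TTheory GRing.Theory Num.Theory.
Import numFieldNormedType.Exports.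

Local Open Scope classical_set_scope.
Local Open Scope ring_scope.

(** The squared norm of the curvature is integrated against a cutoff function.

    Write [T_1, T_2] for the skew-symmetric matrices of torsion coefficients,
    [S = d_2 T_1 - d_1 T_2 + (commutator of T_1 and T_2)] for the curvature and
    [D = |T_1|^2 + |T_2|^2] (Frobenius norms) for the torsion density; in conformal parameters the
    inverse metric cancels the area element, so that the total torsion is the
    integral of [D] over the disc ([total_torsionE]).  Let [eta] be a C^1
    function with values in [0, 1], equal to 1 on the disc of radius [rho] and
    vanishing on the unit circle.  Then the integral of [eta |S|^2] is at least
    the squared L^2-norm [a] of [S] over the smaller disc.  Conversely:

    - the part of [eta S . S] that contains derivatives of [T] is integrated by
      parts.  There is no boundary term because [eta] vanishes on the circle
      ([Rintegral_pd]), and what remains is at most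
      [l/2 |grad (eta S)|^2 + D / (4 l)] for any [l > 0];

    - the commutator satisfies [S . commutator <= |S| sqrt (n - 2) / 2 D]
      ([commutator_pairing]): two applications of the Cauchy-Schwarz inequality,
      where only [n - 2] indices contribute to each entry.

    If the integral of [|grad (eta S)|^2] is at most [2 K] and [|S| <= M], the
    choice [l = a / (2 K)] gives
    [a <= (sqrt (n - 2) M + K / a) * total torsion] ([core_inequality]).

    For the first bound, [|grad (eta S)|^2] is at most
    [4/3 |grad eta|^2 |S|^2 + 4 |grad S|^2].  The slope of [eta] is at most
    [10/9 (1 - rho)^-1], and [4/3 (10/9)^2 < 2], so
    [K = |S|_2^2 / (1 - rho)^2 + 2 |grad S|_2^2] is admissible.  For a constant
    curvature vector the gradient of [S] vanishes, and [rho^2 = 1/2] gives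
    [a = pi |S|^2 / 2] and [K / a = (10/9)^2 / (1 - rho)^2 < 16]; this uses the
    area of a disc ([area_disc]). *)

(** * Functions of class C^k on a set with dense interior *)

Lemma near_in T (D : set T) F (P : T -> Prop) : Filter F ->
  (forall x, D x -> P x) -> \forall x \near within D F, P x.
Proof. by move=> FF DP; apply: filterS (near_withinT D FF). Qed.

Lemma within_sub_cvg T (D D' : set T) F : Filter F -> D' `<=` D ->
  within D' F --> within D F.
Proof.
move=> FF D'D P; rewrite !nbhs_simpl /within /= => FP.
by apply: filterS FP => x DP /D'D /DP.
Qed.

Section CkAlgebra.
Context {R : realType} {V : normedModType R}.
Variable A : set V.
Hypothesis clA : A `<=` closure (A° : set V).
Implicit Types (f g h : V -> R) (v w : V) (dirs : seq V).

Let proper_within w : A w -> ProperFilter (within (A° : set V) (nbhs w)).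
Proof. by move=> /clA wA; apply: within_nbhs_proper. Qed.

Lemma pder_interior v f w : (A° : set V) w -> pder A v f w = 'D_v f w.
Proof. by move=> Aw; rewrite /pder mem_set. Qed.

Lemma near_interior (P : V -> Prop) w :
  (A° : set V) w -> (forall x, A x -> P x) -> \near w, P w.
Proof. by move=> Aw AP; apply: filterS AP Aw. Qed.

Lemma eq_derive_in f g v w : (forall x, A x -> f x = g x) ->
  (A° : set V) w -> 'D_v f w = 'D_v g w.
Proof. by move=> fg Aw; apply: near_eq_derive; exact: near_interior. Qed.

(** At every point [pder] depends only on the values in the interior of [A], so
    this is an equality of functions. *)
Lemma eq_pder f g v : (forall x, A x -> f x = g x) -> pder A v f = pder A v g.
Proof.
move=> fg; apply/funext => w; rewrite /pder.
case: ifPn => [/set_mem Aw|_]; first exact: (eq_derive_in v fg Aw).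
congr (lim _); rewrite eqEsubset; split; apply: near_eq_cvg.
  by apply: near_in => x Ax; exact: eq_derive_in.
by apply: near_in => x Ax; apply/esym; exact: eq_derive_in.
Qed.

Lemma eq_within_continuous f g : (forall x, A x -> f x = g x) ->
  {within A, continuous f} -> {within A, continuous g}.
Proof. by move=> fg; apply: subspace_eq_continuous => x /set_mem /fg. Qed.

Lemma eq_Ck dirs k f g : (forall x, A x -> f x = g x) ->
  Ck A dirs k f -> Ck A dirs k g.
Proof.
case: k => [|k] fg /=; first exact: eq_within_continuous.
move=> [cf df Cf]; split; first exact: eq_within_continuous cf.
- move=> v vd w Aw; apply: near_eq_derivable (df v vd w Aw).
  exact: near_interior.
- by move=> v vd; rewrite -(eq_pder _ fg); apply: Cf.
Qed.

Lemma cvg_interior h w : A w -> {within A, continuous h} ->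
  h x @[x --> within (A° : set V) (nbhs w)] --> h w.
Proof.
move=> Aw /subspace_continuousP /(_ w Aw); apply: cvg_trans.
by apply: cvg_app; apply: within_sub_cvg; exact: interior_subset.
Qed.

(** At a boundary point both sides are limits of the derivative taken in the
    interior, which is dense in [A]. *)
Lemma pder_unique f h v : {within A, continuous h} ->
  (forall w, (A° : set V) w -> 'D_v f w = h w) ->
  forall w, A w -> pder A v f w = h w.
Proof.
move=> ch fh w Aw; rewrite /pder; case: ifPn => [/set_mem /fh //|_].
have PF := proper_within Aw.
apply: cvg_lim => //.
apply: cvg_trans (cvg_interior Aw ch).
by apply: near_eq_cvg; apply: near_in => x Ax; rewrite fh.
Qed.

Lemma within_continuous_add f g : {within A, continuous f} ->
  {within A, continuous g} -> {within A, continuous (f \+ g)}.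
Proof. by move=> cf cg x; apply: cvgD; [exact: cf|exact: cg]. Qed.

Lemma within_continuousM f g : {within A, continuous f} ->
  {within A, continuous g} -> {within A, continuous (f \* g)}.
Proof. by move=> cf cg x; apply: cvgM; [exact: cf|exact: cg]. Qed.

(** The usual rules hold in the interior and extend to [A] by [pder_unique]. *)
Lemma pderD dirs f g v : v \in dirs -> Ck A dirs 1 f -> Ck A dirs 1 g ->
  forall w, A w -> pder A v (f \+ g) w = pder A v f w + pder A v g w.
Proof.
move=> vd [_ df /(_ v vd) cf] [_ dg /(_ v vd) cg].
apply: (pder_unique (h := pder A v f \+ pder A v g)).
  exact: within_continuous_add.
move=> w Aw /=; rewrite deriveD; [|exact: df|exact: dg].
by rewrite !pder_interior.
Qed.

Lemma pderM dirs f g v : v \in dirs -> Ck A dirs 1 f -> Ck A dirs 1 g ->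
  forall w, A w ->
  pder A v (f \* g) w = f w * pder A v g w + g w * pder A v f w.
Proof.
move=> vd [cf df /(_ v vd) cf'] [cg dg /(_ v vd) cg'].
apply: (pder_unique (h := (f \* pder A v g) \+ (g \* pder A v f))).
  by apply: within_continuous_add; exact: within_continuousM.
move=> w Aw /=; rewrite deriveM; [|exact: df|exact: dg].
by rewrite !pder_interior.
Qed.

Lemma Ck_pred dirs k f : Ck A dirs k.+1 f -> Ck A dirs k f.
Proof.
elim: k f => [|k IH] f; first by case.
by move=> [cf df Cf]; split=> // v vd; apply: IH; exact: Cf.
Qed.

Lemma Ck_le dirs k k' f : (k' <= k)%N -> Ck A dirs k f -> Ck A dirs k' f.
Proof.
move=> /subnK <-; elim: (k - k')%N => [//|m IH] Cf.
by apply: IH; apply: Ck_pred.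
Qed.

Lemma CkD dirs k f g : Ck A dirs k f -> Ck A dirs k g ->
  Ck A dirs k (f \+ g).
Proof.
elim: k f g => [|k IH] f g; first exact: within_continuous_add.
move=> Cf Cg.
have C1f : Ck A dirs 1 f by apply: Ck_le Cf.
have C1g : Ck A dirs 1 g by apply: Ck_le Cg.
have [cf df Df] := Cf; have [cg dg Dg] := Cg; split.
- exact: within_continuous_add.
- by move=> v vd w Aw; apply: derivableD; [exact: df|exact: dg].
- move=> v vd; apply: (@eq_Ck _ _ (pder A v f \+ pder A v g)).
    by move=> x Ax; rewrite (pderD vd).
  by apply: IH; [exact: Df|exact: Dg].
Qed.

Lemma CkM dirs k f g : Ck A dirs k f -> Ck A dirs k g ->
  Ck A dirs k (f \* g).
Proof.
elim: k f g => [|k IH] f g; first exact: within_continuousM.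
move=> Cf Cg.
have C1f : Ck A dirs 1 f by apply: Ck_le Cf.
have C1g : Ck A dirs 1 g by apply: Ck_le Cg.
have [cf df Df] := Cf; have [cg dg Dg] := Cg; split.
- exact: within_continuousM.
- by move=> v vd w Aw; apply: derivableM; [exact: df|exact: dg].
- move=> v vd.
  apply: (@eq_Ck _ _ ((f \* pder A v g) \+ (g \* pder A v f))).
    by move=> x Ax; rewrite (pderM vd).
  by apply: CkD; apply: IH; [exact: Ck_pred|exact: Dg|exact: Ck_pred|exact: Df].
Qed.

Lemma pder_cst v (c : R) : forall w, A w -> pder A v (cst c) w = 0.
Proof.
apply: (pder_unique (h := cst 0)) => [|w _]; last by rewrite derive_cst.
by apply: continuous_subspaceT => x; exact: cvg_cst.
Qed.

Lemma Ck_cst dirs k (c : R) : Ck A dirs k (cst c).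
Proof.
elim: k c => [|k IH] c /=.
  by apply: continuous_subspaceT => x; exact: cvg_cst.
split.
- by apply: continuous_subspaceT => x; exact: cvg_cst.
- by move=> v _ w _; exact: derivable_cst.
- by move=> v _; apply: eq_Ck (IH 0) => x Ax; rewrite pder_cst.
Qed.

Lemma CkN dirs k f : Ck A dirs k f -> Ck A dirs k (\- f).
Proof.
move=> Cf; apply: (@eq_Ck _ _ (cst (-1) \* f)) => [x _ /=|].
  by rewrite mulN1r.
by apply: CkM => //; exact: Ck_cst.
Qed.

Lemma Ck_sub dirs k f g : Ck A dirs k f -> Ck A dirs k g ->
  Ck A dirs k (f \- g).
Proof. by move=> Cf Cg; apply: CkD => //; exact: CkN. Qed.

Lemma Ck_sum (I : Type) (s : seq I) dirs k (F : I -> V -> R) :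
  (forall i, Ck A dirs k (F i)) ->
  Ck A dirs k (fun x => \sum_(i <- s) F i x).
Proof.
move=> CF; elim: s => [|i s IH].
  by apply: (@eq_Ck _ _ (cst 0)); [move=> x _; rewrite big_nil|exact: Ck_cst].
apply: (@eq_Ck _ _ (F i \+ (fun x => \sum_(i <- s) F i x))).
  by move=> x _; rewrite big_cons.
by apply: CkD.
Qed.

Lemma pder_sum (I : Type) (s : seq I) dirs v (F : I -> V -> R) :
  v \in dirs -> (forall i, Ck A dirs 1 (F i)) ->
  forall w, A w -> pder A v (fun x => \sum_(i <- s) F i x) w =
                   \sum_(i <- s) pder A v (F i) w.
Proof.
move=> vd CF w Aw; elim: s => [|i s IH].
  rewrite big_nil -[RHS](pder_cst v 0 Aw); congr (pder A v _ w).
  by apply/funext => x; rewrite big_nil.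
have -> : (fun x => \sum_(j <- i :: s) F j x) =
          F i \+ (fun x => \sum_(j <- s) F j x).
  by apply/funext => x; rewrite big_cons.
by rewrite (pderD vd (CF i) (Ck_sum s CF) Aw) IH big_cons.
Qed.

Lemma Ck1_global dirs f (Df : V -> V -> R) : continuous f ->
  (forall v, v \in dirs -> continuous (Df v)) ->
  (forall v, v \in dirs -> forall w, is_derive w v f (Df v w)) ->
  Ck A dirs 1 f /\
  (forall v, v \in dirs -> forall w, A w -> pder A v f w = Df v w).
Proof.
move=> cf cDf df.
have pE v : v \in dirs -> forall w, A w -> pder A v f w = Df v w.
  move=> vd; apply: pder_unique.
    by apply: continuous_subspaceT; exact: cDf.
  by move=> w _; have ? := df v vd w; rewrite derive_val.
split => //; split.
- exact: continuous_subspaceT.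
- by move=> v vd w _; have ? := df v vd w; exact: ex_derive.
- move=> v vd; apply: (@eq_within_continuous (Df v)).
    by move=> x Ax; rewrite pE.
  by apply: continuous_subspaceT; exact: cDf.
Qed.

End CkAlgebra.

(** * The unit disc *)

Section Disc.
Context {R : realType}.
Implicit Types (w : R * R) (rho : R).

Definition sqnorm w : R := w.1 ^+ 2 + w.2 ^+ 2.

Lemma continuous_sqnorm : continuous sqnorm.
Proof.
move=> w; apply: cvgD; rewrite !expr2; apply: cvgM;
  by [exact: cvg_fst|exact: cvg_snd].
Qed.

Lemma sqnorm_ge0 w : 0 <= sqnorm w.
Proof. by rewrite addr_ge0 ?sqr_ge0. Qed.

Lemma open_disc_interior rho w : sqnorm w < rho ^+ 2 -> ((disc rho)° : set _) w.
Proof.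
move=> wr; have : open (sqnorm @^-1` [set x | x < rho ^+ 2]).
  by apply: open_comp; [move=> x _; exact: continuous_sqnorm|exact: open_lt].
move=> oU; have : nbhs w (sqnorm @^-1` [set x | x < rho ^+ 2]).
  exact: open_nbhs_nbhs.
by apply: filterS => x /ltW.
Qed.

Lemma closed_disc rho : closed (@disc R rho).
Proof.
have -> : disc rho = sqnorm @^-1` [set x | x <= rho ^+ 2] by [].
by apply: preimage_closed; [move=> w _; exact: continuous_sqnorm|exact: closed_le].
Qed.

Lemma disc_sub_square rho : 0 <= rho ->
  @disc R rho `<=` `[- rho, rho]%classic `*` `[- rho, rho]%classic.
Proof.
move=> r0 [u v]; rewrite /disc /= => H; split => /=; rewrite in_itv /=;
  rewrite -ler_norml -(ler_pXn2r (n := 2)) ?nnegrE // real_normK ?num_real //.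
- by rewrite (le_trans _ H) // lerDl sqr_ge0.
- by rewrite (le_trans _ H) // lerDr sqr_ge0.
Qed.

Lemma compact_disc rho : 0 <= rho -> compact (@disc R rho).
Proof.
move=> r0; apply: subclosed_compact (disc_sub_square r0).
  exact: closed_disc.
by apply: compact_setX; exact: segment_compact.
Qed.

(** A boundary point [w] is the limit of the interior points [t w], [t < 1]. *)
Lemma disc_sub_closure : B R `<=` closure (B R)°.
Proof.
move=> w Bw U wU.
have cw : (t *: w) @[t --> (1 : R)] --> w.
  rewrite -[X in _ --> X]scale1r.
  by apply: cvgZ; [exact: cvg_id|exact: cvg_cst].
have : \forall t \near (1 : R)^'-, U (t *: w).
  by apply: cvg_at_left_filter cw _ wU.
move=> H; near (1 : R)^'- => t.
exists (t *: w); split; last by near: t.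
apply: open_disc_interior.
have -> : sqnorm (t *: w) = t ^+ 2 * sqnorm w.
  by rewrite /sqnorm /= /GRing.scale /=; ring.
have t0 : 0 < t by near: t; apply: nbhs_left_gt.
have t1 : t < 1 by near: t; apply: nbhs_left_lt.
have sw : sqnorm w <= 1 by move: Bw; rewrite /B /disc /= expr1n.
have := sqnorm_ge0 w; nra.
Unshelve. all: by end_near. Qed.

End Disc.

(** * Borel sets of the plane *)

Section BorelPlane.
Context {R : realType}.
Implicit Types (U A : set (R * R)).

(** The plane is second countable: an open set is the union of the open
    rectangles with rational corners that it contains. *)
Lemma open_measurable_plane U : open U -> measurable U.
Proof.
move=> oU.
pose rect (q : (rat * rat) * (rat * rat)) : set (R * R) :=
  `]ratr q.1.1, ratr q.1.2[%classic `*` `]ratr q.2.1, ratr q.2.2[%classic.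
have -> : U = \bigcup_q (if `[< rect q `<=` U >] then rect q else set0).
  apply/seteqP; split=> [p Up|p [q _]]; last first.
    by case: asboolP => // qU; exact: qU.
  have /nbhs_ballP[e /= e0 eU] : nbhs p U by exact: open_nbhs_nbhs.
  have ltl (x : R) : x - e < x by rewrite ltrBlDr ltrDl.
  have ltr (x : R) : x < x + e by rewrite ltrDl.
  have [a1] := rat_in_itvoo (ltl p.1); have [b1] := rat_in_itvoo (ltr p.1).
  have [a2] := rat_in_itvoo (ltl p.2); have [b2] := rat_in_itvoo (ltr p.2).
  rewrite !in_itv /= => /andP[? ?] /andP[? ?] /andP[? ?] /andP[? ?].
  exists ((a1, b1), (a2, b2)) => //; rewrite ifT.
    by rewrite /rect /= !in_itv /=; split; apply/andP.
  apply/asboolP => x; rewrite /rect /= !in_itv /= => -[/andP[? ?] /andP[? ?]].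
  apply: eU; split; rewrite /ball /= ltr_norml; apply/andP; split; lra.
apply: countable_bigcupT_measurable => [|q]; first exact: countableP.
by case: ifP => // _; apply: measurableX.
Qed.

Lemma closed_measurable_plane A : closed A -> measurable A.
Proof.
by move/closed_openC/open_measurable_plane/measurableC; rewrite setCK.
Qed.

Lemma within_continuous_measurable A (f : R * R -> R) : measurable A ->
  {within A, continuous f} -> measurable_fun A f.
Proof.
move=> mA /continuousP cf; 
apply: (measurability _ (measurable_realfun.RGenOpens.measurableE R)).
move=> _ [_ [a [b ->] <-]].
have : open (f @^-1` `]a, b[ : set (subspace A)) by exact/cf/interval_open.
move=> /open_subspaceP[V oV VA].
by rewrite setIC -VA; apply: measurableI => //; exact: open_measurable_plane.
Qed.

Lemma mu2_compact A : compact A -> (mu2 A < +oo)%E.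
Proof.
move=> cA; have mA : measurable A.
  by apply: closed_measurable_plane; apply: compact_closed cA.
have [M [_ MA]] := compact_bounded cA.
pose r := `|M| + 1.
have AI : A `<=` `[- r, r]%classic `*` `[- r, r]%classic.
  move=> x Ax; have : `|x| <= r.
    by apply: MA => //; rewrite (le_lt_trans (ler_norm _)) // ltrDl.
  rewrite /Num.norm /= ge_max => /andP[x1 x2].
  by split; rewrite /= in_itv /= -ler_norml.
have mI : measurable (`[- r, r]%classic `*` `[- r, r]%classic : set (R * R)).
  exact: measurableX.
apply: le_lt_trans (le_measure mu2 (mem_set mA) (mem_set mI) AI) _.
rewrite [X in (X < _)%E](@product_measure1E _ _ _ _ _
  lebesgue_measure lebesgue_measure) //= !lebesgue_measure_itv /=.
by case: ifP => _; rewrite ?mule0 // -EFinD -EFinM ltry.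
Qed.

Lemma integrable_compact A (f : R * R -> R) : compact A ->
  {within A, continuous f} -> mu2.-integrable A (EFin \o f).
Proof.
move=> cA cf; have mA : measurable A.
  by apply: closed_measurable_plane; apply: compact_closed cA.
apply: measurable_bounded_integrable => //.
- exact: mu2_compact.
- exact: within_continuous_measurable.
- have [M [Mr MA]] := compact_bounded (continuous_compact cf cA).
  exists M; split => // x Mx y Ay; apply: (MA x Mx); exact: imageP.
Qed.

End BorelPlane.

(** * The divergence theorem on the disc *)

Section IntegrationByParts.
Context {R : realType}.
Implicit Types (F : R * R -> R) (i : 'I_2).

Lemma dir_codom i : (dir i : R * R) \in codom dir.
Proof. exact: codom_f. Qed.

Lemma compact_B : compact (B R).
Proof. exact: compact_disc. Qed.

#[local] Hint Resolve compact_B : core.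

Lemma measurable_B :
  measurable (B R : set (measurableTypeR R * measurableTypeR R)).
Proof. by apply: closed_measurable_plane; exact: closed_disc. Qed.

Lemma B_sqnorm (w : R * R) : B R w <-> sqnorm w <= 1.
Proof. by rewrite /B /disc /= expr1n. Qed.

(** The line in direction [dir i] through the point at height [c] on the other
    coordinate axis. *)
Definition line i (c t : R) : R * R := if i == 0 then (t, c) else (c, t).

Lemma sqnorm_line i c t : sqnorm (line i c t) = t ^+ 2 + c ^+ 2.
Proof. by rewrite /line /sqnorm; case: eqP => //= _; rewrite addrC. Qed.

Lemma line_shift i c t h : h *: dir i + line i c t = line i c (h + t).
Proof.
rewrite /line /dir; case: eqP => _; congr (_, _) => /=;
  by rewrite /GRing.scale /=; ring.
Qed.

Lemma continuous_line i c : continuous (line i c).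
Proof.
move=> t; rewrite /line; case: eqP => _.
  by apply: (@cvg_pair _ _ _ (nbhs t) (nbhs t) (nbhs c)); [exact: cvg_id|exact: cvg_cst].
by apply: (@cvg_pair _ _ _ (nbhs t) (nbhs c) (nbhs t)); [exact: cvg_cst|exact: cvg_id].
Qed.

(** The difference quotients along [dir i] are those of a function of one
    variable; this transfers derivatives in both directions. *)
Lemma line_quotient F i c t :
  (fun h : R => h^-1 *: (((F \o line i c) \o shift t) (h *: (1 : R)) -
     (F \o line i c) t)) =
  (fun h : R => h^-1 *: ((F \o shift (line i c t)) (h *: dir i) -
     F (line i c t))).
Proof.
apply/funext => h /=; rewrite line_shift.
by rewrite /GRing.scale /= mulr1.
Qed.

Lemma derivable_line F i c t :
  derivable F (line i c t) (dir i) -> derivable (F \o line i c) t 1.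
Proof. by rewrite /derivable line_quotient. Qed.

Lemma derive_line F i c t :
  'D_1 (F \o line i c) t = 'D_(dir i) F (line i c t).
Proof. by rewrite /derive line_quotient. Qed.

Section Chord.
Variables (i : 'I_2) (c : R).
Hypothesis c1 : c ^+ 2 < 1.
Let a : R := Num.sqrt (1 - c ^+ 2).

Let a_gt0 : 0 < a. Proof. by rewrite sqrtr_gt0 subr_gt0. Qed.

Let a2 : a ^+ 2 = 1 - c ^+ 2.
Proof. by rewrite sqr_sqrtr // subr_ge0 ltW. Qed.

Lemma line_B t : B R (line i c t) <-> `[- a, a]%classic t.
Proof.
rewrite B_sqnorm sqnorm_line /= in_itv /= -ler_norml.
suff -> : (`|t| <= a) = (t ^+ 2 + c ^+ 2 <= 1) by [].
have <- : (`|t| ^+ 2 <= a ^+ 2) = (`|t| <= a) by rewrite ler_sqr ?nnegrE // ltW.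
by rewrite real_normK ?num_real // a2 lerBrDr.
Qed.

Lemma line_B_interior t : `]- a, a[%classic t -> ((B R)°: set _) (line i c t).
Proof.
rewrite /= in_itv /= -ltr_norml => ta; apply: open_disc_interior.
rewrite sqnorm_line expr1n -ltrBrDr -a2 -(real_normK (num_real t)).
by rewrite ltr_pXn2r // ?nnegrE // ltW.
Qed.

Lemma within_line F : {within B R, continuous F} ->
  {within `[- a, a], continuous (F \o line i c)}.
Proof.
move=> cF; apply/subspace_continuousP => t ta.
have /subspace_continuousP /(_ (line i c t)) := cF.
move=> /(_ (iffRL (line_B t) ta)) H.
apply: (cvg_comp _ _ _ H) => P; rewrite /within /= !nbhs_simpl /= => FP.
have FP' : nbhs t (fun x => B R (line i c x) -> P (line i c x)).
  exact: (continuous_line FP).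
apply: filterS FP' => x /= PB xa.
by apply: PB; apply/line_B.
Qed.

Lemma integral_chord F : CkB 1 F -> (forall w, sqnorm w = 1 -> F w = 0) ->
  (\int[lebesgue_measure]_(t in `[(- a)%R, a]) (pd i F (line i c t))%:E = 0)%E.
Proof.
move=> [cF dF cdF] F0.
have aa : - a < a by rewrite gtrN.
have FE (t : R) : t ^+ 2 = a ^+ 2 -> F (line i c t) = 0.
  by move=> ta; apply: F0; rewrite sqnorm_line ta a2 subrK.
have /(continuous_within_itvP _ aa)[cl cr1 cr2] := within_line cF.
rewrite (continuous_FTC2 (F := F \o line i c) aa).
- by rewrite /= !FE ?sqrrN // subee.
- by apply: within_line; exact: cdF (dir_codom i).
- split => // t ta; apply: derivable_line; apply: dF; first exact: dir_codom.
  exact: line_B_interior.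
- move=> t ta; rewrite derive1E derive_line /pd pder_interior //.
  exact: line_B_interior.
Qed.

End Chord.

(** A line that does not cross the open disc meets it in at most one point. *)
Lemma integral_line i c F : CkB 1 F -> (forall w, sqnorm w = 1 -> F w = 0) ->
  (\int[lebesgue_measure]_t ((pd i F \_ (B R)) (line i c t))%:E = 0)%E.
Proof.
move=> CF F0; have [c1|c1] := ltP (c ^+ 2) 1.
  rewrite -[RHS](integral_chord i c1 CF F0) [RHS]integral_mkcond.
  apply: eq_integral => t _; rewrite !patchE.
  have := line_B i c1 t; set J := `[_, _]%classic => BJ.
  have -> : (line i c t \in B R) = (t \in J).
    by apply/idP/idP => /set_mem /BJ /mem_set.
  by case: ifP.
rewrite -[RHS](integral_set1 (fun t => ((pd i F \_ (B R)) (line i c t))%:E) 0).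
rewrite [RHS]integral_mkcond; apply: eq_integral => t _.
rewrite !patchE; case: ifPn => [/set_mem|_]; last by case: ifP.
rewrite B_sqnorm sqnorm_line => tc.
rewrite mem_set //=; apply/eqP; rewrite -sqrf_eq0 eq_le sqr_ge0 andbT.
by rewrite -(lerD2r (c ^+ 2)) add0r (le_trans tc).
Qed.

(** The divergence theorem for functions vanishing on the unit circle: by
    Fubini the integral is computed along chords, where the fundamental theorem
    of calculus applies. *)
Lemma Rintegral_pd i F : CkB 1 F -> (forall w, sqnorm w = 1 -> F w = 0) ->
  \int[mu2]_(w in B R) pd i F w = 0.
Proof.
move=> CF F0; have [_ _ /(_ _ (dir_codom i)) cF] := CF.
rewrite /Rintegral integral_mkcond.
have iF : mu2.-integrable setT ((EFin \o pd i F) \_ (B R)).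
  by apply/(integrable_mkcond _ measurable_B)/integrable_compact.
have -> : (fun w => (pd i F w)%:E) = EFin \o pd i F by [].
have [i0|i1] := eqVneq i 0.
  rewrite -(integral21_prod_meas1 iF) /fubini_G.
  under eq_integral => c _.
    under eq_integral => t _.
      have -> : (((EFin \o pd i F) \_ (B R)) (t, c) =
               ((pd i F \_ (B R)) (line i c t))%:E)%E.
        by rewrite /line i0 eqxx !patchE; case: ifP.
      over.
    rewrite integral_line //.
    over.
  by rewrite integral0.
rewrite -(integral12_prod_meas1 iF) /fubini_F.
under eq_integral => c _.
  under eq_integral => t _.
    have -> : (((EFin \o pd i F) \_ (B R)) (c, t) =
             ((pd i F \_ (B R)) (line i c t))%:E)%E.
      by rewrite /line (negbTE i1) !patchE; case: ifP.
    over.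
  rewrite integral_line //.
  over.
by rewrite integral0.
Qed.

End IntegrationByParts.

(** * A cutoff function *)

Section Cutoff.
Context {R : realType}.
Implicit Types (x t : R) (w : R * R).

(** A remainder bounded by the square of the increment gives differentiability,
    also where the second derivative of [f] has a jump. *)
Lemma is_derive_quadratic_error (f : R -> R) x d :
  (forall h, `|f (h + x) - f x - d * h| <= h ^+ 2) -> is_derive x 1 f d.
Proof.
move=> fd.
have H : h^-1 *: ((f \o shift x) (h *: (1 : R)) - f x) @[h --> 0^'] --> d.
  apply/cvgrPdist_le => e e0; near=> h.
  have h0 : h != 0 by near: h; exact: nbhs_dnbhs_neq.
  have he : `|h| <= e.
    near: h; apply: dnbhs0_le; exact: e0.
  rewrite /= /GRing.scale /= mulr1.
  have -> : d - h^-1 * (f (h + x) - f x) =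
            - (h^-1 * (f (h + x) - f x - d * h)) by field.
  rewrite normrN normrM normfV ler_pdivrMl ?normr_gt0 //.
  rewrite (le_trans (fd h)) // -(real_normK (num_real h)) expr2.
  by rewrite ler_wpM2l.
apply: DeriveDef; first by apply/cvg_ex; exists d.
exact: cvg_lim.
Unshelve. all: by end_near. Qed.

Definition pos x : R := Num.max x 0.

Lemma continuous_pos : continuous pos.
Proof.
by move=> x; apply: continuous_max; [exact: cvg_id|exact: cvg_cst].
Qed.

Lemma posP x : (x <= 0 /\ pos x = 0) \/ (0 <= x /\ pos x = x).
Proof.
rewrite /pos; have [x0|x0] := leP x 0; first by left.
by right; split => //; exact: ltW.
Qed.

Lemma pos_le0 x : x <= 0 -> pos x = 0.
Proof. by move=> x0; rewrite /pos max_r. Qed.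

(** [pos ^+ 2] has second derivative between 0 and 2. *)
Lemma is_derive_pos_sqr x : is_derive x 1 (fun t => pos t ^+ 2) (2 * pos x).
Proof.
apply: is_derive_quadratic_error => h; rewrite ler_norml.
by case: (posP x) => -[x0 ->]; case: (posP (h + x)) => -[hx ->];
  apply/andP; split; nra.
Qed.

Variable rho : R.
Hypothesis rho01 : 0 < rho < 1.

Let rho_gt0 : 0 < rho. Proof. by case/andP: rho01. Qed.
Let rho_lt1 : rho < 1. Proof. by case/andP: rho01. Qed.
Let d : R := (1 - rho) / 5.
Let d_gt0 : 0 < d. Proof. by rewrite divr_gt0 // subr_gt0. Qed.
Let d5 : 1 - rho = 5 * d. Proof. by rewrite /d; field. Qed.

(** A C^1 version of [x |-> pos x], whose slope grows linearly from 0 to 1 on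
    the interval [0, d]. *)
Let ramp x : R := (pos x ^+ 2 - pos (x - d) ^+ 2) / (2 * d).
Let ramp' x : R := (pos x - pos (x - d)) / d.

Let is_derive_ramp x : is_derive x 1 ramp (ramp' x).
Proof.
have H1 := is_derive_pos_sqr x.
have H2 : is_derive x 1 (fun t => pos (t - d) ^+ 2) (2 * pos (x - d)).
  apply: is_derive_quadratic_error => h; rewrite ler_norml.
  have -> : h + x - d = h + (x - d) by rewrite addrA.
  by case: (posP (x - d)) => -[x0 ->]; case: (posP (h + (x - d))) => -[hx ->];
    apply/andP; split; nra.
have -> : ramp = (2 * d)^-1 \*o ((fun t => pos t ^+ 2) - (fun t => pos (t - d) ^+ 2)).
  by apply/funext => t; rewrite /ramp /= mulrC.
apply: is_derive_eq; rewrite /ramp' /GRing.scale /=.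
by field; rewrite gt_eqF.
Qed.

Let ramp'_bound x : 0 <= ramp' x <= 1.
Proof.
have d0 := d_gt0; rewrite /ramp' ler_pdivrMr // mul1r divr_ge0 ?(ltW d_gt0) //=;
  by case: (posP x) => -[x0 ->]; case: (posP (x - d)) => -[xd ->]; lra.
Qed.

Let ramp'_le0 x : x <= 0 -> ramp' x = 0.
Proof.
move=> x0; have xd : x - d <= 0 by have d0 := d_gt0; lra.
by rewrite /ramp' !pos_le0 // subrr mul0r.
Qed.

Let ramp_le0 x : x <= 0 -> ramp x = 0.
Proof.
move=> x0; have xd : x - d <= 0 by have d0 := d_gt0; lra.
by rewrite /ramp !pos_le0 // subrr mul0r.
Qed.

Let h : R := 9 / 10 * (1 - rho).
Let h_gt0 : 0 < h. Proof. by have d0 := d_gt0; rewrite /h d5; lra. Qed.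

Let ramp_end : ramp (1 - rho) = h.
Proof.
have d0 := d_gt0; rewrite /ramp /h d5; case: (posP (5 * d)) => -[x1 ->].
  by exfalso; lra.
case: (posP (5 * d - d)) => -[xd ->]; first by exfalso; lra.
by field; rewrite gt_eqF.
Qed.

Let ramp_bound x : x <= 1 - rho -> 0 <= ramp x <= h.
Proof.
have d0 := d_gt0; rewrite d5 => x5; apply/andP; split.
  rewrite /ramp divr_ge0 //; last by lra.
  by case: (posP x) => -[x1 ->]; case: (posP (x - d)) => -[xd ->]; nra.
rewrite /ramp ler_pdivrMr; last by lra.
rewrite /h d5.
by case: (posP x) => -[x1 ->]; case: (posP (x - d)) => -[xd ->]; nra.
Qed.

Definition radius w : R := Num.sqrt (sqnorm w).

Lemma continuous_radius : continuous radius.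
Proof.
by move=> w; apply: continuous_comp; [exact: continuous_sqnorm|exact: sqrt_continuous].
Qed.

(** Equal to 1 on the disc of radius [rho], vanishing on the unit circle and
    rotationally symmetric.  A tent function with slope [(1 - rho)^-1] is not
    C^1; rounding its corner over a fifth of the annulus increases the slope by
    the factor [10 / 9], which the estimates tolerate. *)
Definition cutoff w : R := 1 - ramp (radius w - rho) / h.

(** The denominator [max (radius w) rho] replaces [radius w], which vanishes at
    the origin: the two agree where [ramp'] is not zero. *)
Definition dcutoff (v w : R * R) : R :=
  - (ramp' (radius w - rho) / h) *
    ((w.1 * v.1 + w.2 * v.2) / Num.max (radius w) rho).


Let is_derive_radius i c t : 0 < t ^+ 2 + c ^+ 2 ->
  is_derive t 1 (fun t => radius (line i c t)) (t / radius (line i c t)).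
Proof.
move=> tc.
have -> : (fun t => radius (line i c t)) = Num.sqrt \o (fun t : R => t ^+ 2 + c ^+ 2).
  by apply/funext => x; rewrite /radius sqnorm_line.
have H1 := is_derive1_sqrt tc.
have H2 : is_derive t 1 (fun t : R => t ^+ 2 + c ^+ 2) (2 * t).
  apply: is_derive_quadratic_error => e.
  rewrite (_ : _ - _ = e ^+ 2); last by ring.
  by rewrite ger0_norm // sqr_ge0.
apply: is_derive_eq; rewrite /radius sqnorm_line; field.
by rewrite sqrtr_eq0 -ltNge.
Qed.

Let is_derive_cutoff_line i c t :
  is_derive t 1 (cutoff \o line i c) (dcutoff (dir i) (line i c t)).
Proof.
have lineE : (line i c t).1 * (dir i).1 + (line i c t).2 * (dir i).2 = t.
  by rewrite /line /dir; case: eqP => _ /=; ring.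
rewrite /dcutoff lineE.
(* Inside the disc of radius [rho] the cutoff is locally constant; elsewhere
   the radius is positive and the chain rule applies. *)
have [tr|tr] := ltP (radius (line i c t)) rho.
  rewrite ramp'_le0; last by rewrite subr_le0 ltW.
  rewrite mul0r oppr0 mul0r.
  apply: (@near_eq_is_derive R R R (cst 1) (cutoff \o line i c) t 1 0) _.
  have : \forall x \near t, radius (line i c x) < rho.
    have cr : {for t, continuous (radius \o line i c)}.
      by apply: continuous_comp; [exact: continuous_line|exact: continuous_radius].
    exact: (cvgr_lt _ cr _ tr).
  apply: filterS => x xr /=.
  by rewrite /cutoff ramp_le0 ?mul0r ?subr0 // subr_le0 ltW.
have r0 : 0 < radius (line i c t) by exact: lt_le_trans tr.
have tc : 0 < t ^+ 2 + c ^+ 2 by move: r0; rewrite /radius sqnorm_line sqrtr_gt0.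
have H1 := is_derive_radius i tc.
have H2 : is_derive t 1 (fun t => radius (line i c t) - rho) (t / radius (line i c t)).
  rewrite -[X in is_derive _ _ _ X]subr0.
  exact: is_deriveB.
have H3 := @is_derive1_comp _ ramp (fun t => radius (line i c t) - rho) t _ _
  (is_derive_ramp (radius (line i c t) - rho)) H2.
have -> : cutoff \o line i c =
  cst 1 - (h^-1 \*o (ramp \o (fun t => radius (line i c t) - rho))).
  by apply/funext => x; rewrite /cutoff /= mulrC.
apply: is_derive_eq; rewrite /GRing.scale /=; field.
by rewrite !gt_eqF.
Qed.

Let continuous_ramp' : continuous ramp'.
Proof.
move=> x; apply: cvgM; last exact: cvg_cst.
apply: cvgB; first exact: continuous_pos.
apply: (@continuous_comp _ _ _ (fun t => t - d)); last exact: continuous_pos.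
by apply: cvgB; [exact: cvg_id|exact: cvg_cst].
Qed.

Let continuous_dcutoff v : continuous (dcutoff v).
Proof.
move=> w; apply: cvgM.
  apply: cvgN; apply: cvgM; last exact: cvg_cst.
  apply: (@continuous_comp _ _ _ (fun w => radius w - rho)); last exact: continuous_ramp'.
  by apply: cvgB; [exact: continuous_radius|exact: cvg_cst].
apply: cvgM.
  by apply: cvgD; (apply: cvgM; last exact: cvg_cst); [exact: cvg_fst|exact: cvg_snd].
apply: cvgV; first by rewrite gt_eqF // lt_max rho_gt0 orbT.
by apply: continuous_max; [exact: continuous_radius|exact: cvg_cst].
Qed.

Let continuous_cutoff : continuous cutoff.
Proof.
move=> w; apply: cvgB; first exact: cvg_cst.
apply: cvgM; last exact: cvg_cst.
apply: (@continuous_comp _ _ _ (fun w => radius w - rho)).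
  by apply: cvgB; [exact: continuous_radius|exact: cvg_cst].
have /@ex_derive/derivable1_diffP := is_derive_ramp (radius w - rho).
exact: differentiable_continuous.
Qed.

Lemma cutoff_C1 : CkB 1 cutoff /\
  (forall i w, B R w -> pd i cutoff w = dcutoff (dir i) w).
Proof.
have [] := @Ck1_global _ _ _ (@disc_sub_closure R) (codom dir) _ _ continuous_cutoff
  (fun v _ => @continuous_dcutoff v).
  move=> _ /codomP[i ->] w.
  pose c := if i == 0 then w.2 else w.1.
  pose t := if i == 0 then w.1 else w.2.
  have -> : w = line i c t.
    by rewrite /line /c /t; case: eqP => _; case: (w).
  have [D1 D2] := is_derive_cutoff_line i c t.
  split; last by rewrite -derive_line.
  by move: D1; rewrite /derivable line_quotient.
by move=> C D; split => // i w; apply: D; exact: dir_codom.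
Qed.

Lemma cutoff_bound w : B R w -> 0 <= cutoff w <= 1.
Proof.
move=> /B_sqnorm w1; rewrite /cutoff.
have : radius w - rho <= 1 - rho.
  by rewrite lerD2r -[leRHS]sqrtr1 ler_wsqrtr.
move=> /ramp_bound /andP[r0 r1].
by rewrite subr_ge0 ler_pdivrMr // mul1r r1 /= gerBl divr_ge0 // ltW.
Qed.

Lemma cutoff_eq1 w : disc rho w -> cutoff w = 1.
Proof.
move=> wr; rewrite /cutoff ramp_le0 ?mul0r ?subr0 // subr_le0.
by rewrite -[leRHS]ger0_norm ?(ltW rho_gt0) // -sqrtr_sqr ler_wsqrtr.
Qed.

Lemma cutoff_eq0 w : sqnorm w = 1 -> cutoff w = 0.
Proof.
by move=> w1; rewrite /cutoff /radius w1 sqrtr1 ramp_end divff ?subrr // gt_eqF.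
Qed.

Lemma dcutoff_bound w :
  dcutoff (dir 0) w ^+ 2 + dcutoff (dir 1) w ^+ 2 <= (10 / 9) ^+ 2 / (1 - rho) ^+ 2.
Proof.
set m := Num.max (radius w) rho.
have m0 : 0 < m by rewrite lt_max rho_gt0 orbT.
set r := ramp' (radius w - rho).
have -> : dcutoff (dir 0) w ^+ 2 + dcutoff (dir 1) w ^+ 2 =
   (10 / 9) ^+ 2 / (1 - rho) ^+ 2 * (r ^+ 2 * (sqnorm w / m ^+ 2)).
  rewrite /dcutoff -/m -/r /dir /= /h /sqnorm.
  by field; rewrite gt_eqF //= gt_eqF // subr_gt0.
rewrite -[leRHS]mulr1 ler_wpM2l ?divr_ge0 ?sqr_ge0 //.
have /andP[r0 r1] := ramp'_bound (radius w - rho).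
have s1 : sqnorm w / m ^+ 2 <= 1.
  rewrite ler_pdivrMr ?exprn_gt0 // mul1r.
  rewrite -[leLHS]sqr_sqrtr ?sqnorm_ge0 // ler_sqr ?nnegrE ?sqrtr_ge0 ?(ltW m0) //.
  by rewrite le_max lexx.
have s0 : 0 <= sqnorm w / m ^+ 2 by rewrite divr_ge0 ?sqnorm_ge0 ?sqr_ge0.
by rewrite mulr_ile1 ?sqr_ge0 // exprn_ile1.
Qed.

End Cutoff.

(** * The quadratic part of the curvature *)

Section Commutator.
Context {R : realType}.

Lemma cauchy_schwarz (I : finType) (P : pred I) (x y : I -> R) :
  (\sum_(i | P i) x i * y i) ^+ 2 <=
  (\sum_(i | P i) x i ^+ 2) * (\sum_(i | P i) y i ^+ 2).
Proof.
(* Lagrange's identity. *)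
have : 0 <= \sum_(i | P i) \sum_(j | P j) (x i * y j - x j * y i) ^+ 2.
  by apply: sumr_ge0 => i _; apply: sumr_ge0 => j _; exact: sqr_ge0.
have -> : \sum_(i | P i) \sum_(j | P j) (x i * y j - x j * y i) ^+ 2 =
  \sum_(i | P i) \sum_(j | P j) (x i ^+ 2 * y j ^+ 2) +
  \sum_(i | P i) \sum_(j | P j) (y i ^+ 2 * x j ^+ 2) -
  2 * \sum_(i | P i) \sum_(j | P j) ((x i * y i) * (x j * y j)).
  rewrite mulr_sumr -big_split -sumrB; apply: eq_bigr => i _ /=.
  rewrite mulr_sumr -big_split -sumrB; apply: eq_bigr => j _ /=.
  by ring.
by rewrite -!big_distrlr /= -!expr2; lra.
Qed.

Variable n : nat.

Lemma sum_upper_pair (g : 'I_n -> 'I_n -> R) :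
  \sum_(p : upper_pair n) g (val p).1 (val p).2 =
  \sum_(s < n) \sum_(t < n | (s < t)%N) g s t.
Proof.
rewrite pair_big_dep /= (reindex_omap (val : upper_pair n -> _) insub) /=.
  by apply: eq_bigl => p; rewrite valK eqxx (valP p).
by move=> p pP; rewrite insubT.
Qed.

Lemma sum_upper_pair_le (g : 'I_n -> 'I_n -> R) :
  (forall s t, 0 <= g s t) -> (forall s t, g s t = g t s) ->
  2 * \sum_(p : upper_pair n) g (val p).1 (val p).2 <= \sum_s \sum_t g s t.
Proof.
move=> g0 gC; rewrite sum_upper_pair mulr_natl mulr2n.
have E : \sum_(s < n) \sum_(t < n | (s < t)%N) g s t =
          \sum_(s < n) \sum_(t < n | (t < s)%N) g s t.
  rewrite (exchange_big_dep predT) //=; apply: eq_bigr => t _.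
  by apply: eq_bigr => s _; exact: gC.
rewrite {1}E -big_split /=; apply: ler_sum => s _.
rewrite [leRHS](bigID (fun t : 'I_n => (t < s)%N)) /= lerD2l.
rewrite [leRHS](bigID (fun t : 'I_n => (s < t)%N)) /=.
have -> : \sum_(t < n | ~~ (t < s)%N && (s < t)%N) g s t =
          \sum_(t < n | (s < t)%N) g s t.
  by apply: eq_bigl => t; case: (ltngtP s t).
by rewrite lerDl sumr_ge0.
Qed.

Variables A1 A2 : 'I_n -> 'I_n -> R.
Hypothesis skew1 : forall s t, A1 s t = - A1 t s.
Hypothesis skew2 : forall s t, A2 s t = - A2 t s.
Hypothesis n2 : (2 <= n)%N.

Let q s t := \sum_o (A1 s o * A2 o t - A2 s o * A1 o t).
Let e s t := A1 s t ^+ 2 + A2 s t ^+ 2.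
Let D := \sum_s \sum_t e s t.

Let A1_diag s : A1 s s = 0. Proof. by have := skew1 s s; lra. Qed.
Let A2_diag s : A2 s s = 0. Proof. by have := skew2 s s; lra. Qed.
Let e_ge0 s t : 0 <= e s t. Proof. by rewrite addr_ge0 ?sqr_ge0. Qed.
Let e_sym s t : e s t = e t s.
Proof. by rewrite /e skew1 skew2 !sqrrN. Qed.

(** Only the [n - 2] indices [o] other than [s] and [t] contribute. *)
Let commutator_entry s t : s != t ->
  q s t ^+ 2 <= (n%:R - 2) * \sum_o e s o * e o t.
Proof.
move=> st; pose P := [pred o | (o != s) && (o != t)].
have -> : q s t = \sum_(o | P o) 1 * (A1 s o * A2 o t - A2 s o * A1 o t).
  rewrite /q (bigID P) /= [X in _ + X]big1 ?addr0.
    by apply: eq_bigr => o _; rewrite mul1r.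
  move=> o; rewrite negb_and !negbK => /orP[]/eqP ->.
    by rewrite A1_diag A2_diag; ring.
  by rewrite A1_diag A2_diag; ring.
apply: le_trans (cauchy_schwarz _ _ _) _.
have -> : \sum_(o | P o) (1 : R) ^+ 2 = n%:R - 2.
  rewrite expr1n sumr_const -natrB //; congr (_%:R).
  have -> : #|P| = #|~: [set s; t]|.
    by apply: eq_card => o; rewrite !inE negb_or.
  by rewrite cardsCs finset.setCK card_ord cards2 st.
rewrite ler_wpM2l ?subr_ge0 ?ler_nat //.
rewrite [leRHS](bigID P) /=; apply: ler_wpDr.
  by apply: sumr_ge0 => o _; rewrite mulr_ge0.
apply: ler_sum => o _; rewrite /e.
rewrite -subr_ge0 (_ : _ - _ = (A1 s o * A1 o t + A2 s o * A2 o t) ^+ 2) ?sqr_ge0 //.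
by ring.
Qed.

(** Every off-diagonal entry of row [s] occurs a second time in column [s]. *)
Let row_le s : \sum_t e s t <= D / 2.
Proof.
rewrite ler_pdivlMr // mulr_natr mulr2n /D [leRHS](bigD1 s) //= lerD2l.
rewrite (bigD1 s) //= [X in X + _]/e A1_diag A2_diag expr0n addr0 add0r.
apply: ler_sum => t ts; rewrite e_sym (bigD1 s) //= lerDl.
by apply: sumr_ge0.
Qed.

Let D_ge0 : 0 <= D.
Proof. by apply: sumr_ge0 => s _; apply: sumr_ge0. Qed.

(** The sum of the products [e s o * e o t] over all indices is the sum of the
    squares of the row sums of [e], hence at most [D / 2 * D] by [row_le]; the
    entries above the diagonal account for at most half of it. *)
Let commutator_norm : \sum_(p : upper_pair n) q (val p).1 (val p).2 ^+ 2 <=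
  (n%:R - 2) / 4 * D ^+ 2.
Proof.
have n0 : 0 <= n%:R - 2 :> R by rewrite subr_ge0 ler_nat.
have H : \sum_(p : upper_pair n) q (val p).1 (val p).2 ^+ 2 <=
    (n%:R - 2) * \sum_(p : upper_pair n) \sum_o e (val p).1 o * e o (val p).2.
  rewrite mulr_sumr; apply: ler_sum => p _; apply: commutator_entry.
  by have := valP p; apply: contraTneq => ->; rewrite ltnn.
apply: le_trans H _; rewrite -mulrA ler_wpM2l //.
have H := @sum_upper_pair_le (fun s t => \sum_o e s o * e o t).
have {H} := H _ _.
have -> : \sum_s \sum_t \sum_o e s o * e o t = \sum_o (\sum_t e o t) ^+ 2.
  under eq_bigr do rewrite exchange_big /=.
  rewrite exchange_big /=; apply: eq_bigr => o _.
  by rewrite expr2 big_distrlr /=; apply: eq_bigr => s _; under eq_bigr do rewrite e_sym.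
have S : \sum_o (\sum_t e o t) ^+ 2 <= D / 2 * D.
  rewrite {2}/D mulr_sumr; apply: ler_sum => o _.
  by rewrite expr2 ler_wpM2r // sumr_ge0.
move=> H; have {}H : 2 * \sum_(p : upper_pair n) \sum_o e (val p).1 o * e o (val p).2
  <= D / 2 * D.
  apply: le_trans S; apply: H => [s t|s t].
    by apply: sumr_ge0 => o _; rewrite mulr_ge0.
  by apply: eq_bigr => o _; rewrite mulrC [e o t]e_sym [e s o]e_sym.
by move: H; lra.
Qed.

Lemma commutator_pairing (x : upper_pair n -> R) :
  \sum_(p : upper_pair n) x p * q (val p).1 (val p).2 <=
  Num.sqrt (\sum_p x p ^+ 2) * (Num.sqrt (n%:R - 2) / 2 * D).
Proof.
have n0 : 0 <= n%:R - 2 :> R by rewrite subr_ge0 ler_nat.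
apply: le_trans (ler_norm _) _.
rewrite -ler_sqr ?nnegrE ?normr_ge0 //; last first.
  by rewrite mulr_ge0 ?sqrtr_ge0 // mulr_ge0 // divr_ge0 ?sqrtr_ge0.
rewrite real_normK ?num_real //.
apply: le_trans (cauchy_schwarz _ _ _) _.
rewrite exprMn sqr_sqrtr; last by apply: sumr_ge0 => p _; exact: sqr_ge0.
rewrite ler_wpM2l //; first by apply: sumr_ge0 => p _; exact: sqr_ge0.
apply: le_trans commutator_norm _.
rewrite !exprMn sqr_sqrtr // exprVn.
by rewrite (_ : 2 ^+ 2 = 4) //; ring.
Qed.

End Commutator.

(** * The area of a disc *)

Section DiscArea.
Context {R : realType}.
Variable r : R.
Hypothesis r_gt0 : 0 < r.

Let half_width (x : R) : R := Num.sqrt (r ^+ 2 - x ^+ 2).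

Let continuous_half_width : continuous half_width.
Proof.
move=> x; apply: (@continuous_comp R R R (fun x => r ^+ 2 - x ^+ 2)).
  by apply: cvgB; [exact: cvg_cst|exact: exprn_continuous].
exact: sqrt_continuous.
Qed.

Let pihalf : - (pi / 2) < pi / 2 :> R.
Proof. by rewrite gtrN // divr_gt0 // pi_gt0. Qed.

Let is_derive_rsin (t : R) : is_derive t 1 (fun t : R => r * sin t) (r * cos t).
Proof. exact: (@is_deriveZ _ _ _ sin r t 1 (cos t)). Qed.

Let continuous_rsin : continuous (fun t : R => r * sin t).
Proof. by move=> t; apply: cvgM; [exact: cvg_cst|exact: continuous_sin]. Qed.

Let continuous_rcos : continuous (fun t : R => r * cos t).
Proof. by move=> t; apply: cvgM; [exact: cvg_cst|exact: continuous_cos]. Qed.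

Let derivable_LR (F : R -> R) a b : continuous F -> (forall t, derivable F t 1) ->
  derivable_oo_LRcontinuous F a b.
Proof.
move=> cF dF; split => [t _||]; first exact: dF.
  by apply: cvg_at_right_filter; exact: cF.
by apply: cvg_at_left_filter; exact: cF.
Qed.

(** The substitution [x = r sin t]. *)
Let integral_half_width :
  (\int[lebesgue_measure]_(x in `[(- r)%R, r]) (2 * half_width x)%:E =
   (pi * r ^+ 2)%:E)%E.
Proof.
have F' : derive1 (fun t : R => r * sin t) = (fun t => r * cos t).
  by apply/funext => t; rewrite derive1E; apply: derive_val.
have Fb : r * sin (pi / 2) = r by rewrite sin_pihalf mulr1.
have Fa : r * sin (- (pi / 2)) = - r by rewrite sinN mulrN Fb.
have := @integration_by_substitution_increasing R (fun t => r * sin t)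
  (fun x => 2 * half_width x) (- (pi / 2)) (pi / 2) (ltW pihalf).
rewrite Fa Fb => ->.
- pose G (t : R) := r ^+ 2 * (t + sin t * cos t).
  have dG (t : R) : is_derive t 1 G (2 * (r * cos t) ^+ 2).
    have -> : G = r ^+ 2 \*o (id + sin * cos) by apply/funext.
    apply: is_derive_eq; rewrite /GRing.scale /= exprMn.
    have E : sin t * sin t = 1 - cos t * cos t by have := cos2sin2 t; lra.
    by rewrite mulrN E; ring.
  transitivity (\int[lebesgue_measure]_(t in `[(- (pi / 2))%R, (pi / 2)%R])
    (2 * (r * cos t) ^+ 2)%:E)%E.
    apply: eq_integral => t; rewrite inE /= in_itv /= => tpi.
    rewrite F'; congr (_%:E); rewrite /half_width.
    change (2 * Num.sqrt (r ^+ 2 - (r * sin t) ^+ 2) * (r * cos t) =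
            2 * (r * cos t) ^+ 2).
    have c0 : 0 <= cos t by exact: cos_ge0_pihalf.
    have -> : r ^+ 2 - (r * sin t) ^+ 2 = (r * cos t) ^+ 2.
      by rewrite !exprMn cos2sin2; ring.
    by rewrite sqrtr_sqr ger0_norm ?mulr_ge0 ?(ltW r_gt0) //; ring.
  rewrite (continuous_FTC2 (F := G) pihalf).
  + rewrite /G sinN cosN cos_pihalf !mulr0 !addr0 -EFinB; congr (_%:E).
    by field.
  + apply: continuous_subspaceT => t; apply: cvgM; first exact: cvg_cst.
    by rewrite expr2; apply: cvgM; exact: continuous_rcos.
  + apply: derivable_LR => t; last exact: ex_derive.
    by have /@ex_derive/derivable1_diffP/differentiable_continuous := dG t.
  + by move=> t _; rewrite derive1E; apply: derive_val.
- by move=> s t sI tI st; rewrite ltr_pM2l // ltr_sin.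
- by rewrite F' => t _; exact: continuous_rcos.
- rewrite F'; apply/cvg_ex; exists (r * cos (- (pi / 2))).
  by apply: cvg_at_right_filter; exact: continuous_rcos.
- rewrite F'; apply/cvg_ex; exists (r * cos (pi / 2)).
  by apply: cvg_at_left_filter; exact: continuous_rcos.
- by apply: derivable_LR => t; [exact: continuous_rsin|exact: ex_derive].
- apply: continuous_subspaceT => x; apply: cvgM; first exact: cvg_cst.
  exact: continuous_half_width.
Qed.

Let xsection_disc (x : R) : xsection (disc r) x =
  if x \in `[- r, r] then `[- half_width x, half_width x]%classic else set0.
Proof.
apply/seteqP; split => [y|y].
  rewrite /xsection /= inE /disc /= => xy.
  have xr : x ^+ 2 <= r ^+ 2 by rewrite (le_trans _ xy) // lerDl sqr_ge0.
  rewrite in_itv /= -ler_norml -(ler_sqr (y := r)) ?nnegrE ?(ltW r_gt0) //.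
  rewrite real_normK ?num_real // xr /= in_itv /= -ler_norml.
  rewrite -ler_sqr ?nnegrE ?sqrtr_ge0 // real_normK ?num_real // sqr_sqrtr ?subr_ge0 //.
  by rewrite lerBrDl.
case: ifPn => // xr; rewrite /= in_itv /= -ler_norml => yx.
rewrite /xsection /= inE /disc /=.
have {}xr : x ^+ 2 <= r ^+ 2.
  move: xr; rewrite in_itv /= -ler_norml -ler_sqr ?nnegrE ?(ltW r_gt0) //.
  by rewrite real_normK ?num_real.
move: yx; rewrite -ler_sqr ?nnegrE ?sqrtr_ge0 // real_normK ?num_real //.
by rewrite sqr_sqrtr ?subr_ge0 // lerBrDl.
Qed.

Lemma area_disc : (mu2 (@disc R r) = (pi * r ^+ 2)%:E)%E.
Proof.
rewrite -integral_half_width /product_measure1 [RHS]integral_mkcond.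
apply: eq_integral => x _; rewrite patchE mem_setE /= xsection_disc.
case: ifP => _; last exact: measure0.
rewrite lebesgue_measure_itv /= lte_fin; case: ltP => [_|h0].
  by rewrite -EFinB; congr (_%:E); ring.
have : half_width x = 0.
  have := sqrtr_ge0 (r ^+ 2 - x ^+ 2); rewrite -/(half_width x) => hx.
  by apply/eqP; rewrite eq_le hx andbT; lra.
by move=> ->; rewrite mulr0.
Qed.

End DiscArea.

(** * Integrals and norms over the disc *)

Section DiscIntegrals.
Context {R : realType}.
Implicit Types (f g : R * R -> R).

Let clB := @disc_sub_closure R.

Definition intB f : R := \int[mu2]_(w in B R) f w.

Lemma integrable_B f : CkB 0 f -> mu2.-integrable (B R) (EFin \o f).
Proof. by move=> cf; exact: integrable_compact (@compact_B R) cf. Qed.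

Lemma intB_add f g : CkB 0 f -> CkB 0 g -> intB (f \+ g) = intB f + intB g.
Proof.
by move=> cf cg; apply: RintegralD;
  [exact: measurable_B|exact: integrable_B|exact: integrable_B].
Qed.

Lemma intB_sub f g : CkB 0 f -> CkB 0 g ->
  intB (fun w => f w - g w) = intB f - intB g.
Proof.
move=> cf cg.
exact: (@RintegralB _ _ _ mu2 _ _ _ measurable_B (integrable_B cf) (integrable_B cg)).
Qed.

Lemma intB_scale c f : CkB 0 f -> intB (fun w => c * f w) = c * intB f.
Proof.
by move=> cf; apply: RintegralZl; [exact: measurable_B|exact: integrable_B].
Qed.

Lemma intB_le f g : CkB 0 f -> CkB 0 g -> (forall w, B R w -> f w <= g w) ->
  intB f <= intB g.
Proof.
move=> cf cg fg.
exact: (@le_Rintegral _ _ _ mu2 _ _ _ measurable_B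
  (integrable_B cf) (integrable_B cg) fg).
Qed.

Lemma eq_intB f g : (forall w, B R w -> f w = g w) -> intB f = intB g.
Proof. by move=> fg; apply: eq_Rintegral => w /set_mem /fg. Qed.

Lemma intB_ge0 f : (forall w, B R w -> 0 <= f w) -> 0 <= intB f.
Proof. by move=> f0; exact: (@Rintegral_ge0 _ _ _ mu2). Qed.

Lemma intB_sum (I : Type) (s : seq I) (F : I -> R * R -> R) :
  (forall i, CkB 0 (F i)) ->
  intB (fun w => \sum_(i <- s) F i w) = \sum_(i <- s) intB (F i).
Proof.
move=> cF; elim: s => [|i s IH].
  rewrite big_nil -[RHS](@Rintegral_set0 _ _ _ mu2 (fun=> 0)).
  rewrite /intB /Rintegral; under eq_integral do rewrite big_nil.
  by rewrite integral0 integral_set0.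
rewrite big_cons -IH -intB_add //; last exact: (Ck_sum clB).
by apply: eq_intB => w _; rewrite big_cons.
Qed.

Lemma continuous_sqrt_B f : CkB 0 f -> CkB 0 (fun w => Num.sqrt (f w)).
Proof.
by move=> cf x; apply: continuous_comp; [exact: cf|exact: sqrt_continuous].
Qed.

Lemma ae_intB_le f g : CkB 0 f -> CkB 0 g ->
  (forall w, B R w -> 0 <= f w) -> (forall w, B R w -> 0 <= g w) ->
  {ae mu2, forall w, B R w -> f w <= g w} -> intB f <= intB g.
Proof.
move=> cf cg f0 g0 fg; rewrite /intB /Rintegral fine_le //.
- by apply: integrable_fin_num; [exact: measurable_B|exact: integrable_B].
- by apply: integrable_fin_num; [exact: measurable_B|exact: integrable_B].
apply: ae_ge0_le_integral => //.
- exact: measurable_B.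
- exact: measurable_int (integrable_B cf).
- exact: measurable_int (integrable_B cg).
Qed.

Lemma disc_sub rho : 0 < rho <= 1 -> @disc R rho `<=` B R.
Proof.
move=> /andP[r0 r1] w wr; apply: le_trans wr _.
by rewrite ler_sqr ?nnegrE // ltW.
Qed.

Lemma integrable_disc rho f : 0 < rho <= 1 -> CkB 0 f ->
  mu2.-integrable (disc rho) (EFin \o f).
Proof.
move=> r01 cf; apply: integrable_compact.
  by apply: compact_disc; case/andP: r01 => /ltW.
exact: continuous_subspaceW (disc_sub r01) cf.
Qed.

Lemma measurable_disc rho :
  measurable (disc rho : set (measurableTypeR R * measurableTypeR R)).
Proof. by apply: closed_measurable_plane; exact: closed_disc. Qed.

Lemma integral_disc_le rho f g : 0 < rho <= 1 -> CkB 0 f -> CkB 0 g ->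
  (forall w, B R w -> 0 <= g w) -> (forall w, disc rho w -> f w <= g w) ->
  \int[mu2]_(w in disc rho) f w <= intB g.
Proof.
move=> r01 cf cg g0 fg; have sub := disc_sub r01.
apply: (@le_trans _ _ (\int[mu2]_(w in disc rho) g w)).
  exact: (@le_Rintegral _ _ _ mu2 _ _ _ (measurable_disc rho)
    (integrable_disc r01 cf) (integrable_disc r01 cg) fg).
rewrite /intB /Rintegral fine_le //.
- by apply: integrable_fin_num; [exact: measurable_disc|exact: integrable_disc].
- by apply: integrable_fin_num; [exact: measurable_B|exact: integrable_B].
apply: ge0_subset_integral => //; first exact: measurable_disc.
- exact: measurable_B.
- exact: measurable_int (integrable_B cg).
Qed.

Lemma Lp_norm2 rho f : 0 < rho <= 1 -> CkB 0 f ->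
  Lp_norm 2%:E rho f ^+ 2 = \int[mu2]_(w in disc rho) (f w ^+ 2).
Proof.
move=> r01 cf; rewrite /Lp_norm.
have cf2 : CkB 0 (fun w => f w ^+ 2) by apply: (CkM clB cf cf).
set I := \int[mu2]_(w in disc rho) (f w ^+ 2).
have I0 : 0 <= I by apply: (@Rintegral_ge0 _ _ _ mu2) => w _; exact: sqr_ge0.
pose g : R * R -> \bar R := EFin \o (f \_ (disc rho)).
have I2 : (\int[mu2]_(w in [set: R * R]) (`|g w| `^ 2) = I%:E)%E.
  have fin : (\int[mu2]_(w in disc rho) (f w ^+ 2)%R%:E)%E \is a fin_num.
    apply: integrable_fin_num; first exact: measurable_disc.
    exact: (integrable_disc r01 cf2).
  rewrite /I /Rintegral fineK // [RHS]integral_mkcond; apply: eq_integral => w _.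
  rewrite /= !patchE; case: ifP => _ /=.
    by rewrite powR_mulrn ?normr_ge0 // real_normK ?num_real.
  have p0 : point = 0 :> R by [].
  by rewrite p0 normr0 powR0.
by rewrite unlock I2 poweR_EFin /= powR12_sqrt // sqr_sqrtr.
Qed.

(** The essential supremum is finite since [f] is bounded on the compact disc;
    [fine] therefore returns its actual value. *)
Lemma Lp_normy_ge f : CkB 0 f ->
  {ae mu2, forall w, B R w -> `|f w| <= Lp_norm +oo%E 1 f}.
Proof.
move=> cf.
have mu0 : (0 < mu2 [set: R * R])%E.
  have := @area_disc R 1 ltr01; set a := mu2 _ => aE.
  apply: (@lt_le_trans _ _ a); first by rewrite aE lte_fin expr1n mulr1 pi_gt0.
  apply: (@le_measure _ _ _ mu2) => //; rewrite inE //.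
  exact: (measurable_disc 1).
set g := EFin \o (f \_ (disc 1)).
have [C C0 fC] : exists2 C : R, 0 <= C & forall w, B R w -> `|f w| <= C.
  have [M [_ MA]] := compact_bounded (continuous_compact cf (@compact_B R)).
  exists (`|M| + 1); first by rewrite addr_ge0.
  move=> w Bw; apply: MA; last exact: imageP.
  by rewrite (le_lt_trans (ler_norm _)) // ltrDl.
have gC : (ess_sup mu2 (abse \o g) <= C%:E)%E.
  apply/ess_supP; apply: nearW => w; rewrite /g /= patchE lee_fin.
  by case: ifP => [/set_mem /fC //|_]; rewrite normr0.
have g0 : (0 <= ess_sup mu2 (abse \o g))%E.
  by apply: ess_sup_gee => //; apply: nearW => w; exact: abse_ge0.
have gE : (ess_sup mu2 (abse \o g) = (Lp_norm +oo%E 1 f)%:E)%E.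
  rewrite /Lp_norm unlock /= mu0 fineK //.
  by rewrite ge0_fin_numE // (le_lt_trans gC) ?ltry.
have := ess_sup_ge mu2 (abse \o g); rewrite gE.
apply: filterS => w; rewrite /g /= lee_fin patchE => H Bw.
by move: H; rewrite mem_set.
Qed.

Lemma Lp_norm_ge0 p rho f : 0 <= Lp_norm p rho f.
Proof. by rewrite /Lp_norm fine_ge0 // Lnorm_ge0. Qed.

End DiscIntegrals.

(** * Torsion and curvature of a normal section *)

Section Torsion.
Context {R : realType}.
Variables (n m : nat) (X : R * R -> 'rV[R]_m) (N : 'I_n -> R * R -> 'rV[R]_m).
Hypothesis onsN : ONS X N.

Let clB := @disc_sub_closure R.

Lemma Ck_dot k (F G : R * R -> 'rV[R]_m) : CkBv k F -> CkBv k G ->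
  CkB k (fun w => dot (F w) (G w)).
Proof. by move=> cF cG; apply: (Ck_sum clB) => j; exact: (CkM clB (cF j) (cG j)). Qed.

Lemma Ck_pdv k i (F : R * R -> 'rV[R]_m) : CkBv k.+1 F -> CkBv k (pdv i F).
Proof.
move=> cF j; have [_ _ /(_ _ (dir_codom i))] := cF j.
by apply: (eq_Ck) => w _; rewrite mxE.
Qed.

Lemma pd_dot i (F G : R * R -> 'rV[R]_m) : CkBv 1 F -> CkBv 1 G ->
  forall w, B R w ->
  pd i (fun x => dot (F x) (G x)) w = dot (F w) (pdv i G w) + dot (pdv i F w) (G w).
Proof.
move=> cF cG w Bw.
have := @pder_sum _ _ _ clB _ (index_enum 'I_m) _ _ (fun j x => F x 0 j * G x 0 j)
  (dir_codom i) (fun j => CkM clB (cF j) (cG j)) _ Bw.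
rewrite /pd /dot => ->; rewrite -big_split; apply: eq_bigr => j _.
apply: etrans (pderM clB (dir_codom i) (cF j) (cG j) Bw) _.
by rewrite [X in _ + X = _]mulrC !mxE.
Qed.

Let N3 s : CkBv 3 (N s). Proof. by have [] := onsN. Qed.

Lemma N_Ck k s : (k <= 3)%N -> CkBv k (N s).
Proof. by move=> k3 j; apply: (Ck_le k3); exact: N3. Qed.

Lemma torsion_C2 s t i : CkB 2 (torsion N s t i).
Proof. by apply: Ck_dot; [exact: Ck_pdv (N3 s)|exact: N_Ck]. Qed.

(** Differentiate [N_s . N_t = delta_st]. *)
Lemma torsion_skew s t i w : B R w -> torsion N s t i w = - torsion N t s i w.
Proof.
move=> Bw; have [_ _ orthN] := onsN.
have := pd_dot i (N_Ck s (isT : (1 <= 3)%N)) (N_Ck t (isT : (1 <= 3)%N)) Bw.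
rewrite /pd (eq_pder (g := cst (s == t)%:R)); last by move=> x Bx; exact: orthN.
rewrite (pder_cst clB) // => /eqP; rewrite eq_sym addrC addr_eq0 => /eqP.
rewrite /torsion => ->; congr (- _).
by apply: eq_bigr => j _; rewrite mulrC.
Qed.

Lemma curvature_C1 s t : CkB 1 (curvature N s t 0 1).
Proof.
have T1 s' t' i : CkB 1 (torsion N s' t' i).
  exact: (@Ck_le _ _ _ _ 2 1 _ isT (torsion_C2 s' t' i)).
apply: (CkD clB); last first.
  apply: (Ck_sum clB) => o.
  by apply: (Ck_sub clB); apply: (CkM clB); exact: T1.
apply: (Ck_sub clB).
  by have [_ _ /(_ _ (dir_codom 1))] := torsion_C2 s t 0.
by have [_ _ /(_ _ (dir_codom 0))] := torsion_C2 s t 1.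
Qed.

(** The sum runs over ordered pairs: each torsion coefficient with [s < t] is
    counted twice. *)
Definition torsion_density (w : R * R) : R :=
  \sum_s \sum_t (torsion N s t 0 w ^+ 2 + torsion N s t 1 w ^+ 2).

Let sqr_torsion_C0 s t i : CkB 0 (fun w => torsion N s t i w ^+ 2).
Proof.
have T0 : CkB 0 (torsion N s t i) by exact: (@Ck_le _ _ _ _ 2 0 _ isT (torsion_C2 s t i)).
exact: (CkM clB T0 T0).
Qed.

Let density_summand_C0 s t :
  CkB 0 (fun w => torsion N s t 0 w ^+ 2 + torsion N s t 1 w ^+ 2).
Proof. exact: (CkD clB (@sqr_torsion_C0 s t 0) (@sqr_torsion_C0 s t 1)). Qed.

Lemma torsion_density_C0 : CkB 0 torsion_density.
Proof.
apply: (@Ck_sum _ _ _ clB _ _ _ 0) => s; apply: (@Ck_sum _ _ _ clB _ _ _ 0) => t.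
exact: density_summand_C0.
Qed.

Lemma torsion_density_ge0 w : 0 <= torsion_density w.
Proof.
by do 2!apply: sumr_ge0 => ? _; rewrite addr_ge0 ?sqr_ge0.
Qed.

Hypothesis immX : immersion X.
Hypothesis confX : conformally_parametrized X.

Let area_elt_neq0 w : B R w -> area_elt X w != 0.
Proof.
move=> Bw; apply/eqP => W0.
have /eqP : metric X w 0 0 = 0 by rewrite (confX Bw) W0 mul0r.
rewrite mxE /dot psumr_eq0 => [|j _]; last by rewrite -expr2 sqr_ge0.
move=> /allP X0.
have Xu : pdv 0 X w = 0.
  apply/rowP => j; rewrite [RHS]mxE; apply/eqP.
  by have := X0 j (mem_index_enum j); rewrite -expr2 sqrf_eq0.
by have := immX Bw; rewrite Xu free_cons span_seq1 mem0v.
Qed.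

Let conformal_trace (T : 'I_2 -> R) (a : R) : a != 0 ->
  (\sum_(i < 2) \sum_(j < 2) invmx (a%:M : 'M[R]_2) i j * T i * T j) * a =
  T 0 ^+ 2 + T 1 ^+ 2.
Proof.
move=> a0; rewrite invmx_scalar.
have E (i : 'I_2) : \sum_(j < 2) ((a^-1)%:M : 'M[R]_2) i j * T i * T j = a^-1 * T i ^+ 2.
  rewrite (bigD1 i) //= big1 ?addr0 => [|j ji].
    by rewrite mxE eqxx mulr1n mulrA.
  by rewrite mxE eq_sym (negbTE ji) mulr0n !mul0r.
under eq_bigr do rewrite E.
rewrite -mulr_sumr mulrAC mulVf // mul1r big_ord_recl big_ord1.
by congr (_ + T _ ^+ 2); exact: val_inj.
Qed.

(** In conformal parameters the inverse metric cancels the area element. *)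
Lemma total_torsionE : total_torsion X N = intB torsion_density.
Proof.
rewrite /total_torsion /torsion_density (intB_sum _ (F := fun s w => \sum_t _)).
  apply: eq_bigr => s _; rewrite intB_sum //; apply: eq_bigr => t _.
  apply: eq_intB => w Bw; have W0 := area_elt_neq0 Bw.
  have -> : metric X w = (area_elt X w)%:M.
    by apply/matrixP => i j; rewrite (confX Bw) !mxE mulr_natr.
  exact: (conformal_trace (fun i => torsion N s t i w)).
by move=> s; apply: (@Ck_sum _ _ _ clB _ _ _ 0) => t; exact: density_summand_C0.
Qed.

End Torsion.

(** * The fundamental inequality *)

Section PointwiseAlgebra.
Context {R : realType}.
Implicit Types (l : R).

Lemma young (l x y : R) : 0 < l -> x * y <= l / 2 * x ^+ 2 + y ^+ 2 / (2 * l).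
Proof.
move=> l0; rewrite -subr_ge0.
rewrite (_ : _ - _ = (l * x - y) ^+ 2 / (2 * l)).
  by rewrite divr_ge0 ?sqr_ge0 // mulr_ge0 // ltW.
by field; rewrite gt_eqF.
Qed.

(** The structure equation [s = dt1 - dt0 + q] is multiplied by [e * s] and
    summed.  The product rule replaces the derivatives [dt1], [dt0] of the
    torsion by total derivatives [P1], [P0] and by products of the torsion with
    the derivatives [g0], [g1] of [e * s]; the latter are split by Young's
    inequality. *)
Lemma torsion_pairing (I : finType) (e l b d : R)
    (s q g0 g1 t0 t1 P1 P0 dt1 dt0 : I -> R) : 0 < l ->
  (forall p, s p = dt1 p - dt0 p + q p) ->
  (forall p, P1 p = e * s p * dt1 p + t0 p * g1 p) ->
  (forall p, P0 p = e * s p * dt0 p + t1 p * g0 p) ->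
  e * (\sum_p s p * q p) <= b ->
  2 * (\sum_p (t0 p ^+ 2 + t1 p ^+ 2)) <= d ->
  e * (\sum_p s p ^+ 2) <= \sum_p (P1 p - P0 p) +
    (l / 2 * \sum_p (g0 p ^+ 2 + g1 p ^+ 2) + (4 * l)^-1 * d + b).
Proof.
move=> l0 sE P1E P0E qb td.
have E p : e * s p ^+ 2 = (P1 p - P0 p) + (g0 p * t1 p + - g1 p * t0 p) +
    e * (s p * q p).
  rewrite P1E P0E; have : e * s p * s p = e * s p * (dt1 p - dt0 p + q p).
    by rewrite -sE.
  by rewrite expr2; lra.
rewrite mulr_sumr (eq_bigr _ (fun p _ => E p)) big_split /= big_split /= -mulr_sumr.
rewrite -addrA lerD2l; apply: lerD => //.
have Y p : g0 p * t1 p + - g1 p * t0 p <=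
    l / 2 * (g0 p ^+ 2 + g1 p ^+ 2) + (2 * l)^-1 * (t0 p ^+ 2 + t1 p ^+ 2).
  have := young (g0 p) (t1 p) l0; have := young (- g1 p) (t0 p) l0.
  by rewrite sqrrN ![_ / (2 * l)]mulrC; lra.
apply: le_trans (ler_sum _ (fun p _ => Y p)) _.
rewrite big_split /= -!mulr_sumr lerD2l.
rewrite (_ : (2 * l)^-1 = (4 * l)^-1 * 2); last by field; rewrite gt_eqF.
by rewrite -mulrA ler_wpM2l // invr_ge0 mulr_ge0 // ltW.
Qed.

End PointwiseAlgebra.

Section CoreInequality.
Context {R : realType}.
Variables (n m : nat) (X : R * R -> 'rV[R]_m) (N : 'I_n -> R * R -> 'rV[R]_m).
Implicit Types (f : R * R -> R) (w : R * R).
Hypothesis n2 : (2 <= n)%N.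
Hypothesis onsN : ONS X N.
Variable rho : R.
Hypothesis rho01 : 0 < rho < 1.

Let clB := @disc_sub_closure R.
Let T s t i := torsion N s t i.
Let S (p : upper_pair n) := curvature N (val p).1 (val p).2 0 1.
Let eta := cutoff rho.
Let etaS p (w : R * R) : R := eta w * S p w.
Let q s t w : R := \sum_(o < n) (T s o 0 w * T o t 1 w - T s o 1 w * T o t 0 w).
Let D := torsion_density N.
Let absS (w : R * R) : R := enorm (curvature_vector N w).
Let c : R := Num.sqrt (n%:R - 2) / 2.

(** The squared norm of the gradient of [eta S]. *)
Definition cut_gradient (w : R * R) : R :=
  \sum_p (pd 0 (etaS p) w ^+ 2 + pd 1 (etaS p) w ^+ 2).

Lemma absS_sqr w : absS w ^+ 2 = \sum_p S p w ^+ 2.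
Proof.
rewrite /absS /enorm sqr_sqrtr; last by apply: sumr_ge0 => p _; exact: sqr_ge0.
by apply: eq_bigr => p _; rewrite ffunE.
Qed.

Lemma absS_ge0 w : 0 <= absS w. Proof. exact: sqrtr_ge0. Qed.

Let T1 s t i : CkB 1 (T s t i).
Proof. exact: (@Ck_le _ _ _ _ 2 1 _ isT (@torsion_C2 _ _ _ _ _ onsN s t i)). Qed.

Let S1 p : CkB 1 (S p). Proof. exact: (curvature_C1 onsN). Qed.

Let eta1 : CkB 1 eta. Proof. by have [] := cutoff_C1 rho01. Qed.

Let etaS1 p : CkB 1 (etaS p).
Proof. exact: (CkM clB eta1 (S1 p)). Qed.

Let C1_C0 f : CkB 1 f -> CkB 0 f.
Proof. exact: (@Ck_le _ _ _ _ 1 0 f isT). Qed.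

Let pd_C0 i f : CkB 1 f -> CkB 0 (pd i f).
Proof. by move=> [_ _ /(_ _ (dir_codom i))]. Qed.

Let sqr_C0 f : CkB 0 f -> CkB 0 (fun w => f w ^+ 2).
Proof. by move=> cf; exact: (CkM clB cf cf). Qed.

Lemma absS_C0 : CkB 0 absS.
Proof.
have cS : CkB 0 (fun w => \sum_p S p w ^+ 2).
  by apply: (@Ck_sum _ _ _ clB _ _ _ 0) => p; exact: (@sqr_C0 _ (@C1_C0 _ (S1 p))).
apply: (@eq_Ck _ _ _ _ 0 (fun w => Num.sqrt (\sum_p S p w ^+ 2))).
  move=> w _; rewrite /absS /enorm; congr Num.sqrt.
  by apply: eq_bigr => p _; rewrite ffunE.
exact: continuous_sqrt_B cS.
Qed.

Lemma cut_gradient_C0 : CkB 0 cut_gradient.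
Proof.
apply: (@Ck_sum _ _ _ clB _ _ _ 0) => p.
have H i : CkB 0 (fun w => pd i (etaS p) w ^+ 2).
  exact: (@sqr_C0 _ (@pd_C0 i _ (etaS1 p))).
exact: (@CkD _ _ _ clB _ 0 _ _ (H 0) (H 1)).
Qed.

Let flux p i w : R := etaS p w * T (val p).1 (val p).2 i w.

Let flux1 p i : CkB 1 (flux p i).
Proof. exact: (CkM clB (etaS1 p) (@T1 _ _ i)). Qed.

Let curl w : R := \sum_p (pd 1 (flux p 0) w - pd 0 (flux p 1) w).

Let curl_summand_C0 p : CkB 0 (fun w => pd 1 (flux p 0) w - pd 0 (flux p 1) w).
Proof.
have H1 : CkB 0 (pd 1 (flux p 0)) by exact: (@pd_C0 1 _ (flux1 p 0)).
have H0 : CkB 0 (pd 0 (flux p 1)) by exact: (@pd_C0 0 _ (flux1 p 1)).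
exact: (@Ck_sub _ _ _ clB _ 0 _ _ H1 H0).
Qed.

Let intB_curl : intB curl = 0.
Proof.
rewrite /curl intB_sum //; apply: big1 => p _.
have flux0 i w : sqnorm w = 1 -> flux p i w = 0.
  by move=> w1; rewrite /flux /etaS /eta cutoff_eq0 // !mul0r.
have Z i j : intB (pd i (flux p j)) = 0.
  exact: (@Rintegral_pd _ i (flux p j) (flux1 p j) (@flux0 j)).
apply: etrans (intB_sub (@pd_C0 1 _ (flux1 p 0)) (@pd_C0 0 _ (flux1 p 1))) _.
apply: etrans (congr2 (fun a b => a - b) (Z 1 0) (Z 0 1)) _.
exact: subrr.
Qed.

Let pointwise (l : R) w : 0 < l -> B R w ->
  eta w * absS w ^+ 2 <=
  curl w + (l / 2 * cut_gradient w + (4 * l)^-1 * D w + c * (absS w * D w)).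
Proof.
move=> l0 Bw; rewrite absS_sqr.
have M i p j : pd i (flux p j) w = eta w * S p w * pd i (T (val p).1 (val p).2 j) w +
    T (val p).1 (val p).2 j w * pd i (etaS p) w.
  exact: (pderM clB (dir_codom i) (etaS1 p) (@T1 (val p).1 (val p).2 j) Bw).
have sk i s t : T s t i w = - T t s i w by exact: (torsion_skew onsN).
apply: (@torsion_pairing _ _ _ _ _ _ _ (fun p => q (val p).1 (val p).2 w)
  _ _ _ _ _ _ _ _ l0 _ (fun p => M 1 p 0) (fun p => M 0 p 1)) => //.
- have /andP[e0 e1] := cutoff_bound rho01 Bw.
  have := @commutator_pairing _ n (fun s t => T s t 0 w) (fun s t => T s t 1 w)
    (sk 0) (sk 1) n2 (fun p => S p w).
  rewrite -absS_sqr sqrtr_sqr ger0_norm ?absS_ge0 // => H.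
  have DE : absS w * (c * D w) = c * (absS w * D w) by ring.
  have P0 : 0 <= c * (absS w * D w).
    rewrite mulr_ge0 ?divr_ge0 ?sqrtr_ge0 // mulr_ge0 ?absS_ge0 //.
    exact: torsion_density_ge0.
  apply: le_trans (_ : eta w * (c * (absS w * D w)) <= _).
    by rewrite ler_wpM2l // -DE.
  by rewrite -[leRHS]mul1r ler_wpM2r.
- apply: (@sum_upper_pair_le _ n (fun s t => T s t 0 w ^+ 2 + T s t 1 w ^+ 2)).
    by move=> s t; rewrite addr_ge0 ?sqr_ge0.
  have sqr_opp (x y : R) : x = - y -> x ^+ 2 = y ^+ 2 by move=> ->; exact: sqrrN.
  move=> s t.
  exact: (congr2 +%R (sqr_opp _ _ (sk 0 s t)) (sqr_opp _ _ (sk 1 s t))).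
Qed.

Hypothesis immX : immersion X.
Hypothesis confX : conformally_parametrized X.

Let TT := total_torsion X N.

Lemma total_torsion_ge0 : 0 <= TT.
Proof.
rewrite /TT (total_torsionE onsN immX confX); apply: intB_ge0 => w _.
exact: torsion_density_ge0.
Qed.

Let integrated (l M : R) : 0 < l -> 0 <= M ->
  {ae mu2, forall w, B R w -> absS w <= M} ->
  intB (fun w => eta w * absS w ^+ 2) <=
  l / 2 * intB cut_gradient + (4 * l)^-1 * TT + c * (M * TT).
Proof.
move=> l0 M0 SM.
have cD : CkB 0 D by exact: torsion_density_C0 onsN.
have cS := absS_C0; have cG := cut_gradient_C0.
have k0 (a : R) : CkB 0 (fun=> a : R) by exact: (Ck_cst clB).
have cSD : CkB 0 (fun w => absS w * D w) by exact: (@CkM _ _ _ clB _ 0 _ _ cS cD).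
have c1 : CkB 0 (fun w => l / 2 * cut_gradient w).
  exact: (@CkM _ _ _ clB _ 0 _ _ (@k0 _) cG).
have c2 : CkB 0 (fun w => (4 * l)^-1 * D w).
  exact: (@CkM _ _ _ clB _ 0 _ _ (@k0 _) cD).
have c3 : CkB 0 (fun w => c * (absS w * D w)).
  exact: (@CkM _ _ _ clB _ 0 _ _ (@k0 _) cSD).
have c12 : CkB 0 (fun w => l / 2 * cut_gradient w + (4 * l)^-1 * D w).
  exact: (@CkD _ _ _ clB _ 0 _ _ c1 c2).
have c123 : CkB 0 (fun w => l / 2 * cut_gradient w + (4 * l)^-1 * D w +
    c * (absS w * D w)) by exact: (@CkD _ _ _ clB _ 0 _ _ c12 c3).
have cc : CkB 0 curl.
  by apply: (@Ck_sum _ _ _ clB _ _ _ 0) => p; exact: curl_summand_C0.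
have ce : CkB 0 (fun w => eta w * absS w ^+ 2).
  exact: (@CkM _ _ _ clB _ 0 _ _ (@C1_C0 _ eta1) (@sqr_C0 _ cS)).
apply: le_trans (intB_le ce (@CkD _ _ _ clB _ 0 _ _ cc c123) (fun w => pointwise l0)) _.
rewrite intB_add // intB_curl add0r.
rewrite (intB_add c12 c3) (intB_add c1 c2) !intB_scale //.
rewrite /TT (total_torsionE onsN immX confX) -/D lerD2l.
rewrite ler_wpM2l ?divr_ge0 ?sqrtr_ge0 // -intB_scale //.
have D0 w : 0 <= D w by exact: torsion_density_ge0.
apply: ae_intB_le => //.
- exact: (@CkM _ _ _ clB _ 0 _ _ (@k0 _) cD).
- by move=> w _; rewrite mulr_ge0 ?absS_ge0.
- by move=> w _; rewrite mulr_ge0.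
- have FF := @ae_filter_ringOfSetsType _ _ _ (mu2 : {measure set _ -> \bar R}).
  by apply: (@filterS _ _ FF) SM => w SM Bw; rewrite ler_wpM2r // SM.
Qed.

(** With the weight [l = a / (2 K)] the gradient term is at most [a / 2] and is
    absorbed in the left-hand side. *)
Lemma core_inequality (a K M : R) : 0 < a -> 0 < K -> 0 <= M ->
  {ae mu2, forall w, B R w -> absS w <= M} ->
  a <= intB (fun w => eta w * absS w ^+ 2) ->
  intB cut_gradient <= 2 * K ->
  a <= (Num.sqrt (n%:R - 2) * M + K / a) * TT.
Proof.
move=> a0 K0 M0 SM aI GK.
have l0 : 0 < a / (2 * K) by rewrite divr_gt0 // mulr_gt0.
have := le_trans aI (integrated l0 M0 SM).
have -> : (4 * (a / (2 * K)))^-1 = K / a / 2.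
  by field; rewrite !gt_eqF.
have : a / (2 * K) / 2 * intB cut_gradient <= a / 2.
  rewrite (_ : a / 2 = a / (2 * K) / 2 * (2 * K)); last by field; rewrite gt_eqF.
  by rewrite ler_wpM2l // divr_ge0 // ltW.
rewrite /c; set s := Num.sqrt _; set Ka := K / a; lra.
Qed.

End CoreInequality.

(** * The two lower bounds *)

Section GradientBound.
Context {R : realType}.

Lemma sqr_sum_le (x y : R) : (x + y) ^+ 2 <= 4 * x ^+ 2 + 4 / 3 * y ^+ 2.
Proof.
rewrite -subr_ge0 (_ : _ - _ = (3 * x - y) ^+ 2 / 3); last by field.
by rewrite divr_ge0 ?sqr_ge0.
Qed.

(** The gradient of a product [e * s], where [g0], [g1] are the derivatives of
    [s] and [d0], [d1] those of [e].  The constants leave room for the slope of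
    the cutoff: [4/3 (10/9)^2 = 400/243 < 2]. *)
Lemma gradient_product_le (I : finType) (e d0 d1 k : R) (s g0 g1 : I -> R) :
  0 <= e <= 1 -> d0 ^+ 2 + d1 ^+ 2 <= (10 / 9) ^+ 2 * k ->
  \sum_p ((e * g0 p + s p * d0) ^+ 2 + (e * g1 p + s p * d1) ^+ 2) <=
  2 * (k * (\sum_p s p ^+ 2) + 2 * \sum_p (g0 p ^+ 2 + g1 p ^+ 2)).
Proof.
move=> /andP[e0 e1] dk.
have e2 : e ^+ 2 <= 1 by rewrite exprn_ile1.
have k0 : 0 <= k.
  have := sqr_ge0 d0; have := sqr_ge0 d1.
  have : 0 < (10 / 9 : R) ^+ 2 by rewrite exprn_gt0.
  nra.
rewrite mulrDr !mulr_sumr -big_split /=; apply: ler_sum => p _.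
have h0 := sqr_sum_le (e * g0 p) (s p * d0).
have h1 := sqr_sum_le (e * g1 p) (s p * d1).
have m0 : e ^+ 2 * g0 p ^+ 2 <= g0 p ^+ 2 by rewrite ler_piMl ?sqr_ge0.
have m1 : e ^+ 2 * g1 p ^+ 2 <= g1 p ^+ 2 by rewrite ler_piMl ?sqr_ge0.
have ms : s p ^+ 2 * (d0 ^+ 2 + d1 ^+ 2) <= s p ^+ 2 * ((10 / 9) ^+ 2 * k).
  by rewrite ler_wpM2l ?sqr_ge0.
have sk : 0 <= k * s p ^+ 2 by rewrite mulr_ge0 ?sqr_ge0.
by move: h0 h1; rewrite !exprMn; lra.
Qed.

End GradientBound.

Section LowerBounds.
Context {R : realType}.
Variables (n m : nat) (X : R * R -> 'rV[R]_m) (N : 'I_n -> R * R -> 'rV[R]_m).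
Implicit Types (f : R * R -> R) (w : R * R).
Hypothesis n2 : (2 <= n)%N.
Hypothesis onsN : ONS X N.
Hypothesis immX : immersion X.
Hypothesis confX : conformally_parametrized X.

Let clB := @disc_sub_closure R.
Let S (p : upper_pair n) := curvature N (val p).1 (val p).2 0 1.
Let absS w : R := enorm (curvature_vector N w).
Let gradS w : R := grad_norm (curvature_vector N) w.

Let S1 p : CkB 1 (S p). Proof. exact: (curvature_C1 onsN). Qed.

Let pd_S_C0 i p : CkB 0 (pd i (S p)).
Proof. by have [_ _ /(_ _ (dir_codom i))] := S1 p. Qed.

Let cS : CkB 0 absS. Proof. exact: (absS_C0 onsN). Qed.

Let cS2 : CkB 0 (fun w => absS w ^+ 2).
Proof. exact: (@CkM _ _ _ clB _ 0 _ _ cS cS). Qed.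

Lemma curvature_vectorE p : (fun x => curvature_vector N x p) = S p.
Proof. by apply/funext => x; rewrite ffunE. Qed.

Lemma gradS_sqr w : gradS w ^+ 2 = \sum_p (pd 0 (S p) w ^+ 2 + pd 1 (S p) w ^+ 2).
Proof.
have E i : enorm (pdf i (curvature_vector N) w) ^+ 2 = \sum_p pd i (S p) w ^+ 2.
  rewrite /enorm sqr_sqrtr; last by apply: sumr_ge0 => p _; exact: sqr_ge0.
  by apply: eq_bigr => p _; rewrite ffunE curvature_vectorE.
rewrite /gradS /grad_norm sqr_sqrtr; last by rewrite addr_ge0 ?sqr_ge0.
apply: etrans (congr2 +%R (E 0) (E 1)) _.
by rewrite -big_split.
Qed.

Let gradS2_C0 : CkB 0 (fun w => \sum_p (pd 0 (S p) w ^+ 2 + pd 1 (S p) w ^+ 2)).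
Proof.
apply: (@Ck_sum _ _ _ clB _ _ _ 0) => p.
have H i : CkB 0 (fun w => pd i (S p) w ^+ 2).
  exact: (@CkM _ _ _ clB _ 0 _ _ (@pd_S_C0 i p) (@pd_S_C0 i p)).
exact: (@CkD _ _ _ clB _ 0 _ _ (H 0) (H 1)).
Qed.

Let gradS_C0 : CkB 0 gradS.
Proof.
apply: (@eq_Ck _ _ _ _ 0 (fun w =>
  Num.sqrt (\sum_p (pd 0 (S p) w ^+ 2 + pd 1 (S p) w ^+ 2)))).
  by move=> w _; rewrite -gradS_sqr sqrtr_sqr ger0_norm // sqrtr_ge0.
exact: continuous_sqrt_B gradS2_C0.
Qed.

Let pd_cut rho p i w : 0 < rho < 1 -> B R w ->
  pd i (fun x => cutoff rho x * S p x) w =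
  cutoff rho w * pd i (S p) w + S p w * dcutoff rho (dir i) w.
Proof.
move=> rho01 Bw; have [C1 <- //] := cutoff_C1 rho01.
exact: (pderM clB (dir_codom i) C1 (S1 p) Bw).
Qed.

Let cut_gradient_le rho w : 0 < rho < 1 -> B R w ->
  cut_gradient N rho w <=
  2 * (((1 - rho) ^+ 2)^-1 * absS w ^+ 2 + 2 * gradS w ^+ 2).
Proof.
move=> rho01 Bw; rewrite absS_sqr gradS_sqr.
have E p : pd 0 (fun x => cutoff rho x * S p x) w ^+ 2 +
           pd 1 (fun x => cutoff rho x * S p x) w ^+ 2 =
  (cutoff rho w * pd 0 (S p) w + S p w * dcutoff rho (dir 0) w) ^+ 2 +
  (cutoff rho w * pd 1 (S p) w + S p w * dcutoff rho (dir 1) w) ^+ 2.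
  by rewrite (pd_cut p 0 rho01 Bw) (pd_cut p 1 rho01 Bw).
apply: le_trans (_ : _ <= _) (gradient_product_le _ _ _ (cutoff_bound rho01 Bw)
  (dcutoff_bound rho01 w)).
by rewrite /cut_gradient (eq_bigr _ (fun p _ => E p)).
Qed.

Let cutoff_S2_C0 rho : 0 < rho < 1 ->
  CkB 0 (fun w => cutoff rho w * absS w ^+ 2).
Proof.
move=> rho01; have [C1 _] := cutoff_C1 rho01.
exact: (@CkM _ _ _ clB _ 0 _ _ (@Ck_le _ _ _ _ 1 0 _ isT C1) cS2).
Qed.

Lemma le_int_cutoff rho : 0 < rho < 1 ->
  \int[mu2]_(w in disc rho) (absS w ^+ 2) <= intB (fun w => cutoff rho w * absS w ^+ 2).
Proof.
move=> rho01; have /andP[r0 r1] := rho01.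
apply: integral_disc_le => //.
- by rewrite r0 ltW.
- exact: cutoff_S2_C0.
- move=> w Bw; have /andP[e0 _] := cutoff_bound rho01 Bw.
  by rewrite mulr_ge0 ?sqr_ge0.
- by move=> w wr; rewrite cutoff_eq1 ?mul1r.
Qed.

Lemma torsion_lower_bound rho : 0 < rho < 1 -> 0 < Lp_norm 2%:E rho absS ->
  let bound :=
    (Num.sqrt (n%:R - 2) * Lp_norm +oo%E 1 absS
     + Lp_norm 2%:E 1 absS ^+ 2 / ((1 - rho) ^+ 2 * Lp_norm 2%:E rho absS ^+ 2)
     + 2 * Lp_norm 2%:E 1 gradS ^+ 2 / Lp_norm 2%:E rho absS ^+ 2)^-1
    * Lp_norm 2%:E rho absS ^+ 2 in
  bound <= total_torsion X N /\ 0 < bound.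
Proof.
move=> rho01 a0; have /andP[r0 r1] := rho01.
have r01 : 0 < rho <= 1 by rewrite r0 ltW.
have one : 0 < (1 : R) <= 1 by rewrite ltr01 lexx.
set M := Lp_norm +oo%E 1 absS.
set a := Lp_norm 2%:E rho absS ^+ 2.
set L := Lp_norm 2%:E 1 absS ^+ 2.
set G := Lp_norm 2%:E 1 gradS ^+ 2.
move=> bound.
have aE : a = \int[mu2]_(w in disc rho) (absS w ^+ 2) by exact: Lp_norm2.
have LE : L = intB (fun w => absS w ^+ 2) by exact: Lp_norm2.
have GE : G = intB (fun w => gradS w ^+ 2) by exact: Lp_norm2.
have {}a0 : 0 < a by rewrite exprn_gt0.
have aI : a <= intB (fun w => cutoff rho w * absS w ^+ 2).
  by rewrite aE; exact: le_int_cutoff.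
have aL : a <= L.
  by rewrite aE LE; apply: integral_disc_le => // w _; exact: sqr_ge0.
have G0 : 0 <= G by exact: sqr_ge0.
have M0 : 0 <= M by exact: Lp_norm_ge0.
have k0 : 0 < ((1 - rho) ^+ 2)^-1 by rewrite invr_gt0 exprn_gt0 // subr_gt0.
pose K := ((1 - rho) ^+ 2)^-1 * L + 2 * G.
have K0 : 0 < K.
  apply: ltr_wpDr; first exact: mulr_ge0.
  by apply: mulr_gt0 => //; exact: lt_le_trans aL.
have SM : {ae mu2, forall w, B R w -> absS w <= M}.
  have FF := @ae_filter_ringOfSetsType _ _ _ (mu2 : {measure set _ -> \bar R}).
  apply: (@filterS _ _ FF) (Lp_normy_ge cS) => w H Bw.
  by apply: le_trans (H Bw); exact: ler_norm.
have cG2 : CkB 0 (fun w => gradS w ^+ 2).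
  exact: (@CkM _ _ _ clB _ 0 _ _ gradS_C0 gradS_C0).
have kC (x : R) : CkB 0 (fun=> x : R) by exact: (Ck_cst clB).
have GK : intB (cut_gradient N rho) <= 2 * K.
  have c1 : CkB 0 (fun w => ((1 - rho) ^+ 2)^-1 * absS w ^+ 2).
    exact: (@CkM _ _ _ clB _ 0 _ _ (@kC _) cS2).
  have c2 : CkB 0 (fun w => 2 * gradS w ^+ 2).
    exact: (@CkM _ _ _ clB _ 0 _ _ (@kC _) cG2).
  have c12 : CkB 0 (fun w => ((1 - rho) ^+ 2)^-1 * absS w ^+ 2 + 2 * gradS w ^+ 2).
    exact: (@CkD _ _ _ clB _ 0 _ _ c1 c2).
  rewrite /K LE GE -(intB_scale _ cS2) -(intB_scale _ cG2) -(intB_add c1 c2).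
  rewrite -(intB_scale _ c12); apply: intB_le.
  - exact: (cut_gradient_C0 onsN rho01).
  - exact: (@CkM _ _ _ clB _ 0 _ _ (@kC _) c12).
  - by move=> w Bw; exact: cut_gradient_le.
have core := core_inequality n2 onsN rho01 immX confX a0 K0 M0 SM aI GK.
have KE : Num.sqrt (n%:R - 2) * M + L / ((1 - rho) ^+ 2 * a) + 2 * G / a =
          Num.sqrt (n%:R - 2) * M + K / a.
  by rewrite /K; field; rewrite gt_eqF //= subr_eq0 gt_eqF.
have den0 : 0 < Num.sqrt (n%:R - 2) * M + K / a.
  by apply: ltr_wpDl; [rewrite mulr_ge0 ?sqrtr_ge0|exact: divr_gt0].
by rewrite /bound KE ler_pdivrMl // core mulr_gt0 ?invr_gt0.
Qed.

Lemma torsion_lower_bound_constant (v : {ffun upper_pair n -> R}) :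
  (forall w, B R w -> curvature_vector N w = v) ->
  2^-1 * (pi * enorm v ^+ 2 / (Num.sqrt (n%:R - 2) * enorm v + 16))
  <= total_torsion X N.
Proof.
move=> Sv; set s := enorm v.
have T0 : 0 <= total_torsion X N by exact: (total_torsion_ge0 onsN immX confX).
have s_ge0 : 0 <= s by exact: sqrtr_ge0.
have [s0|s0] := leP s 0.
  have -> : s = 0 by apply/eqP; rewrite eq_le s0.
  by rewrite expr0n /= mulr0 mul0r mulr0.
have absE w : B R w -> absS w = s by move=> Bw; rewrite /absS Sv.
(* [rho <= 13/18] is what [k <= 16] requires: [1 - 13/18 = (10/9) / 4]. *)
pose rho : R := Num.sqrt 2^-1.
have rho2 : rho ^+ 2 = 2^-1 by rewrite sqr_sqrtr.
have r0 : 0 < rho by rewrite sqrtr_gt0 invr_gt0.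
have r_lt : rho <= 13 / 18 by nra.
have rho01 : 0 < rho < 1 by rewrite r0 /=; lra.
pose k : R := (10 / 9) ^+ 2 / (1 - rho) ^+ 2.
have k16 : k <= 16.
  rewrite /k ler_pdivrMr; last by rewrite exprn_gt0 //; lra.
  by rewrite !expr2; nra.
have k0 : 0 < k by rewrite divr_gt0 // exprn_gt0 //; lra.
have kC (x : R) : CkB 0 (fun=> x : R) by exact: (Ck_cst clB).
have p0 : 0 < pi :> R by exact: pi_gt0.
pose a : R := s ^+ 2 * (pi / 2).
have a0 : 0 < a by rewrite mulr_gt0 ?exprn_gt0 // divr_gt0.
have intC r (x : R) : 0 < r -> \int[mu2]_(w in @disc R r) x = x * (pi * r ^+ 2).
  move=> rgt0; apply: etrans (@Rintegral_cst _ _ _ mu2 _ (measurable_disc r) x) _.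
  by congr (_ * _); apply: (congr1 fine (area_disc rgt0)).
have aI : a <= intB (fun w => cutoff rho w * absS w ^+ 2).
  apply: le_trans (le_int_cutoff rho01).
  rewrite (@eq_Rintegral _ _ _ mu2 _ (fun=> s ^+ 2)); last first.
    move=> w /set_mem wr; rewrite absE //; apply: disc_sub wr.
    by rewrite r0 /=; case/andP: rho01 => _ /ltW.
  by rewrite intC // rho2 /a.
pose K := k * s ^+ 2 * (pi / 2).
have K0 : 0 < K.
  apply: mulr_gt0; last exact: divr_gt0.
  by apply: mulr_gt0 => //; exact: exprn_gt0.
have pd0 i p w : B R w -> pd i (S p) w = 0.
  move=> Bw; rewrite /pd (@eq_pder _ _ _ _ (cst (v p))) ?(pder_cst clB) //.
  by move=> x Bx; rewrite /= -(Sv x Bx) ffunE.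
have cutE w : B R w -> cut_gradient N rho w <= k * s ^+ 2.
  move=> Bw; rewrite /cut_gradient.
  have E p : pd 0 (fun x => cutoff rho x * S p x) w ^+ 2 +
           pd 1 (fun x => cutoff rho x * S p x) w ^+ 2 =
    S p w ^+ 2 * (dcutoff rho (dir 0) w ^+ 2 + dcutoff rho (dir 1) w ^+ 2).
    rewrite (pd_cut p 0 rho01 Bw) (pd_cut p 1 rho01 Bw).
    by rewrite (pd0 0 p w Bw) (pd0 1 p w Bw); ring.
  rewrite (eq_bigr _ (fun p _ => E p)) -mulr_suml -absS_sqr -/(absS w) absE //.
  by rewrite mulrC ler_wpM2r ?sqr_ge0 //; exact: dcutoff_bound.
have GK : intB (cut_gradient N rho) <= 2 * K.
  apply: le_trans (intB_le (cut_gradient_C0 onsN rho01) (@kC (k * s ^+ 2)) cutE) _.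
  rewrite /intB (intC 1) // expr1n /K; lra.
have SM : {ae mu2, forall w, B R w -> absS w <= s}.
  have FF := @ae_filter_ringOfSetsType _ _ _ (mu2 : {measure set _ -> \bar R}).
  by apply: (@filterE _ _ FF) => w Bw; rewrite absE.
have core := core_inequality n2 onsN rho01 immX confX a0 K0 s_ge0 SM aI GK.
have KE : K / a = k by rewrite /K -(mulrA k) mulfK // gt_eqF.
have q0 : 0 <= Num.sqrt (n%:R - 2) * s by rewrite mulr_ge0 ?sqrtr_ge0.
rewrite mulrA ler_pdivrMr; last by lra.
rewrite KE in core.
have aE : 2^-1 * (pi * s ^+ 2) = a by rewrite /a; ring.
rewrite aE; apply: le_trans core _; rewrite mulrC ler_wpM2l //.
by rewrite lerD2l.
Qed.

End LowerBounds.

Theorem mainTheorem2 (R : realType) (n : nat)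
    (X : R * R -> 'rV[R]_(n + 2)) (N : 'I_n -> R * R -> 'rV[R]_(n + 2)) :
  (2 <= n)%N ->
  CkBv 4 X -> immersion X -> conformally_parametrized X ->
  ONS X N -> critical X N ->
  let S := curvature_vector N in
  let absS := fun w => enorm (S w) in
  (exists2 w, B R w & S w != 0) ->
  (~ (exists c, forall w, B R w -> S w = c) ->
   forall rho : R, 0 < rho < 1 -> 0 < Lp_norm 2%:E rho absS ->
   let bound :=
     (Num.sqrt (n%:R - 2) * Lp_norm +oo%E 1 absS
      + Lp_norm 2%:E 1 absS ^+ 2
        / ((1 - rho) ^+ 2 * Lp_norm 2%:E rho absS ^+ 2)
      + 2 * Lp_norm 2%:E 1 (grad_norm S) ^+ 2
        / Lp_norm 2%:E rho absS ^+ 2)^-1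
     * Lp_norm 2%:E rho absS ^+ 2 in
   bound <= total_torsion X N /\ 0 < bound)
  /\
  (forall c, (forall w, B R w -> S w = c) ->
   2^-1 * (pi * enorm c ^+ 2 / (Num.sqrt (n%:R - 2) * enorm c + 16))
     <= total_torsion X N).
Proof.
move=> n2 _ immX confX onsN _ S absS _; split.
  by move=> _ rho; exact: (torsion_lower_bound n2 onsN immX confX).
by move=> c; exact: (torsion_lower_bound_constant n2 onsN immX confX).
Qed.
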